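(* There is a universal constant $C>0$ such that the following holds. Let $\mathcal{X}\subseteq\mathbb{R}^d$ be a nonempty closed convex set of diameter at most $R>0$, let $F:\mathcal{X}\to\mathbb{R}$ be convex, and let $\lambda>0$, $\epsilon>0$. Then there is a step budget $T\le C\sqrt{\lambda R^2/\epsilon}$ such that algorithm RECAPP (given in the context), run for $T$ iterations, outputs $x=x_T\in\mathcal{X}$ with $$\mathbb{E}F(x)-\min_{x'\in\mathcal{X}}F(x')\le\epsilon ,$$ using one call to $\mathrm{WarmStart}_{F,\lambda}$ and at most $C\sqrt{\lambda R^2/\epsilon}$ calls to each of $\mathrm{ApproxProx}_{F,\lambda}$ and $\mathrm{UnbiasedProx}_{F,\lambda}$. Moreover, if every call to $\mathrm{UnbiasedProx}_{F,\lambda}$ is implemented by the procedure MLMC (given in the context) with $p=1/2$ and $j_0=2$, then the expected total number of calls to $\mathrm{ApproxProx}_{F,\lambda}$ is at most $C\sqrt{\lambda R^2/\epsilon}$.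
   Context: $\|\cdot\|$ is the Euclidean norm; $\mathrm{Proj}_{\mathcal X}$ is Euclidean projection onto $\mathcal X$. $F$ is differentiable at the points of $\mathcal X$ (its gradient enters the Bregman divergence below). For $s\in\mathcal X$, $F^\lambda_s(x):=F(x)+\frac{\lambda}{2}\|x-s\|^2$ and $\mathrm{prox}_{F,\lambda}(s):=\arg\min_{x\in\mathcal X}F^\lambda_s(x)$. Bregman divergences: $V^F_x(x'):=F(x')-F(x)-\langle\nabla F(x),x'-x\rangle$ and $V^{\mathrm e}_x(x'):=\frac12\|x'-x\|^2$. Oracles (possibly randomized; each call uses fresh independent randomness, so its guarantee holds conditionally on its inputs and the past). Write $x^\star=\mathrm{prox}_{F,\lambda}(s)$. - $\mathrm{ApproxProx}_{F,\lambda}(s;x_{\rm init},x_{\rm prev})$, for $s,x_{\rm init},x_{\rm prev}\in\mathcal X$, returns $x\in\mathcal X$ with $\mathbb E F^\lambda_s(x)-F^\lambda_s(x^\star)\le\frac18\left(\lambda V^{\mathrm e}_{x^\star}(x_{\rm init})+V^F_{x^\star}(x_{\rm prev})\right)$. - $\mathrm{UnbiasedProx}_{F,\lambda}(s;x_{\rm prev})$, for $s,x_{\rm prev}\in\mathcal X$, returns $x\in\mathbb R^d$ with $\mathbb E x=x^\star$ and $\mathbb E\|x-x^\star\|^2\le\frac{1}{4\lambda}\left(\lambda V^{\mathrm e}_{x^\star}(s)+V^F_{x^\star}(x_{\rm prev})\right)$. - $\mathrm{WarmStart}_{F,\lambda}(R^2)$ returns $x_0\in\mathcal X$ with $\mathbb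 E F(x_0)-\min_{x'\in\mathcal X}F(x')\le\lambda R^2$. RECAPP (parameters $\lambda$, $T$): set $\alpha_0=1$ and $x_0=v_0=\mathrm{WarmStart}_{F,\lambda}(R^2)$. For $t=0,\dots,T-1$: let $\alpha_{t+1}\in[0,1]$ satisfy $\frac{1}{\alpha_{t+1}^2}-\frac1{\alpha_{t+1}}=\frac1{\alpha_t^2}$; $s_t=(1-\alpha_{t+1})x_t+\alpha_{t+1}v_t$; $x_{t+1}=\mathrm{ApproxProx}_{F,\lambda}(s_t;s_t,x_t)$; $\tilde x_{t+1}=\mathrm{UnbiasedProx}_{F,\lambda}(s_t;x_t)$; $v_{t+1}=\mathrm{Proj}_{\mathcal X}\left(v_t-\frac1{\alpha_{t+1}}(s_t-\tilde x_{t+1})\right)$. Return $x_T$. MLMC (input $s,x_{\rm prev}\in\mathcal X$; parameters $p\in[0,1)$, integer $j_0\ge0$): $x^{(0)}=\mathrm{ApproxProx}_{F,\lambda}(s;s,x_{\rm prev})$; sample $J_+\in\{0,1,2,\dots\}$ independently with $\mathbb P[J_+=k]=(1-p)p^k$; $J=j_0+J_+$; for $j=0,\dots,J-1$ set $x^{(j+1)}=\mathrm{ApproxProx}_{F,\lambda}(s;x^{(j)},x^{(j)})$; $p_J=(1-p)p^{J_+}$; return $x^{(j_0)}+p_J^{-1}\left(x^{(J)}-x^{(\max\{J-1,j_0\})}\right)$. *)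

(* Defs.v *)
From HB Require Import structures.
From mathcomp Require Import all_boot all_order all_algebra.
From mathcomp Require Import all_classical all_reals all_analysis.
Set Implicit Arguments.
Unset Strict Implicit.
Unset Printing Implicit Defensive.
Import Order.TTheory GRing.Theory Num.Theory numFieldNormedType.Exports.
Local Open Scope classical_set_scope.
Local Open Scope ring_scope.

(* The library norm on 'rV[R]_d is the sup norm, which induces the usual
   topology; the Euclidean norm is defined here. *)
Definition dotv (R : realType) (d : nat) (u v : 'rV[R]_d) : R :=
  \sum_(i < d) u 0 i * v 0 i.
Definition enorm (R : realType) (d : nat) (u : 'rV[R]_d) : R :=
  Num.sqrt (dotv u u).

Definition borelV (R : realType) (d : nat) :=
  g_sigma_algebraType (@open 'rV[R]_d).

Section objective.
Context (R : realType) (d : nat).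
Local Notation vec := 'rV[R]_d.
Implicit Types (X : set vec) (F f : vec -> R) (lambda : R) (s x y : vec).

(* Every function minimized below has a minimizer on X under the hypotheses of
   the theorem, and a unique one in the case of prox and proj. *)
Definition argmin X f : vec :=
  get [set x | X x /\ forall y, X y -> f x <= f y].

Definition minval X f : R := f (argmin X f).

Definition proj X y : vec := argmin X (fun x => enorm (x - y)).

Definition regularized F lambda s x : R := F x + lambda / 2 * enorm (x - s) ^+ 2.

Definition prox X F lambda s : vec := argmin X (regularized F lambda s).

(* The objective is a function on X only; it is represented by a total F whose
   values off X are irrelevant. Accordingly, differentiability and the gradient
   are taken along the neighborhoods of x within X, which is implied by
   differentiability in a full neighborhood when F extends outside X. *)
Definition differentiable_on X F : Prop :=
  forall x, X x -> differentiable (F : vec -> R^o) (within X (nbhs x)).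

(* ['d F _ h] is the inner product of the gradient of F at x with h. It does not
   depend on the choice of the gradient when h = y - x with x and y in X, even
   if X is not full-dimensional. *)
Definition breg X F x y : R :=
  F y - F x - 'd (F : vec -> R^o) (within X (nbhs x)) (y - x).

Definition breg_e x y : R := 2^-1 * enorm (y - x) ^+ 2.

End objective.

(* A randomized oracle answers a query q with [answer q u], where u is a seed
   drawn from [seed_law]; see [expect] for the freshness of the seeds. *)
Record oracle (R : realType) (d : nat) (Q : Type) := Oracle {
  seed_display : measure_display ;
  seed : measurableType seed_display ;
  seed_law : probability seed R ;
  answer : Q -> seed -> 'rV[R]_d }.

Section oracle_guarantees.
Context (R : realType) (d : nat).
Local Notation vec := 'rV[R]_d.
Local Notation bvec := (borelV R d).
Variables (X : set vec) (F : vec -> R) (lambda : R).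

Local Notation reg := (regularized F lambda).
Local Notation prx := (prox X F lambda).

(* query: (s, x_init, x_prev) *)
Definition is_ApproxProx (O : oracle R d (vec * vec * vec)) : Prop :=
  [/\ measurable_fun
        ([set z | [/\ X z.1.1.1, X z.1.1.2 & X z.1.2]]
          : set (bvec * bvec * bvec * seed O))
        (fun z : bvec * bvec * bvec * seed O => answer z.1 z.2 : bvec),
      forall s xinit xprev u, X s -> X xinit -> X xprev ->
        X (@answer _ _ _ O (s, xinit, xprev) u)
    & forall s xinit xprev, X s -> X xinit -> X xprev ->
        ((\int[seed_law O]_u (reg s (answer (s, xinit, xprev) u))%:E)
          - (reg s (prx s))%:E
        <= (8^-1 * (lambda * breg_e (prx s) xinit
                    + breg X F (prx s) xprev))%:E)%E].

(* query: (s, x_prev) *)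
Definition is_UnbiasedProx (O : oracle R d (vec * vec)) : Prop :=
  [/\ measurable_fun
        ([set z | X z.1.1 /\ X z.1.2] : set (bvec * bvec * seed O))
        (fun z : bvec * bvec * seed O => answer z.1 z.2 : bvec),
      forall s xprev, X s -> X xprev -> forall i : 'I_d,
        (\int[seed_law O]_u (answer (s, xprev) u 0 i)%:E = (prx s 0 i)%:E)%E
    & forall s xprev, X s -> X xprev ->
        (\int[seed_law O]_u (enorm (answer (s, xprev) u - prx s) ^+ 2)%:E
        <= ((4 * lambda)^-1 * (lambda * breg_e (prx s) s
                               + breg X F (prx s) xprev))%:E)%E].

(* D is the diameter parameter; D ^+ 2 is the argument of the oracle *)
Definition is_WarmStart (D : R) (O : oracle R d unit) : Prop :=
  [/\ measurable_fun setT (fun u : seed O => answer tt u : bvec),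
      forall u, X (@answer _ _ _ O tt u)
    & ((\int[seed_law O]_u (F (answer tt u))%:E) - (minval X F)%:E
      <= (lambda * D ^+ 2)%:E)%E].

End oracle_guarantees.

(* Randomized procedures as programs that issue oracle calls. [Geometric p]
   draws k with probability (1 - p) * p ^+ k. *)
Inductive prog (R : realType) (d : nat) (A : Type) : Type :=
  | Ret of A
  | WarmStart of ('rV[R]_d -> prog R d A)
  | ApproxProx of 'rV[R]_d & 'rV[R]_d & 'rV[R]_d & ('rV[R]_d -> prog R d A)
  | UnbiasedProx of 'rV[R]_d & 'rV[R]_d & ('rV[R]_d -> prog R d A)
  | Geometric of R & (nat -> prog R d A).
Arguments Ret {R d A} _.

Fixpoint bind (R : realType) (d : nat) (A B : Type) (m : prog R d A)
    (h : A -> prog R d B) : prog R d B :=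
  match m with
  | Ret a => h a
  | WarmStart k => WarmStart (fun x => bind (k x) h)
  | ApproxProx s xi xp k => ApproxProx s xi xp (fun x => bind (k x) h)
  | UnbiasedProx s xp k => UnbiasedProx s xp (fun x => bind (k x) h)
  | Geometric p k => Geometric p (fun n => bind (k n) h)
  end.

Record calls := Calls { n_warm : nat ; n_approx : nat ; n_unbiased : nat }.

Definition add_calls (c c' : calls) : calls :=
  Calls (n_warm c + n_warm c') (n_approx c + n_approx c')
        (n_unbiased c + n_unbiased c').

Section semantics.
Context (R : realType) (d : nat).
Local Notation vec := 'rV[R]_d.
Variables (OW : oracle R d unit) (OA : oracle R d (vec * vec * vec))
  (OU : oracle R d (vec * vec)).

(* Expected value of f (calls made, output) for a run of m. Each call integrates
   over a seed of its own, with its inputs and everything preceding the call held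
   fixed: the seeds of distinct calls (and the geometric draws) are independent. *)
Fixpoint expect (A : Type) (m : prog R d A) (f : calls -> A -> \bar R) : \bar R :=
  match m with
  | Ret a => f (Calls 0 0 0) a
  | WarmStart k =>
      \int[seed_law OW]_u
        expect (k (answer tt u)) (f \o add_calls (Calls 1 0 0))
  | ApproxProx s xi xp k =>
      \int[seed_law OA]_u
        expect (k (answer (s, xi, xp) u)) (f \o add_calls (Calls 0 1 0))
  | UnbiasedProx s xp k =>
      \int[seed_law OU]_u
        expect (k (answer (s, xp) u)) (f \o add_calls (Calls 0 0 1))
  | Geometric p k =>
      \sum_(0 <= n <oo) (((1 - p) * p ^+ n)%:E * expect (k n) f)%E
  end%E.

(* P (calls made) (output) holds whatever the random outcomes *)
Fixpoint surely (A : Type) (m : prog R d A) (P : calls -> A -> Prop) : Prop :=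
  match m with
  | Ret a => P (Calls 0 0 0) a
  | WarmStart k =>
      forall u : seed OW,
        surely (k (answer tt u)) (P \o add_calls (Calls 1 0 0))
  | ApproxProx s xi xp k =>
      forall u : seed OA,
        surely (k (answer (s, xi, xp) u)) (P \o add_calls (Calls 0 1 0))
  | UnbiasedProx s xp k =>
      forall u : seed OU,
        surely (k (answer (s, xp) u)) (P \o add_calls (Calls 0 0 1))
  | Geometric p k => forall n, surely (k n) P
  end.

End semantics.

Section algorithms.
Context (R : realType) (d : nat).
Local Notation vec := 'rV[R]_d.
Local Notation prog := (prog R d).

(* These conditions determine alpha uniquely. *)
Definition recapp_weights (alpha : nat -> R) : Prop :=
  alpha 0%N = 1 /\
  forall t, 0 <= alpha t.+1 <= 1 /\
            alpha t.+1 ^- 2 - (alpha t.+1)^-1 = alpha t ^- 2.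

(* The last n iterations, from iteration t and the state x = x_t, v = v_t;
   [unbiased s xprev] is the implementation of UnbiasedProx. *)
Fixpoint recapp_loop (X : set vec) (alpha : nat -> R)
    (unbiased : vec -> vec -> prog vec) (n t : nat) (x v : vec) : prog vec :=
  if n is n'.+1 then
    let a := alpha t.+1 in
    let s := (1 - a) *: x + a *: v in
    ApproxProx s s x (fun x' =>
    bind (unbiased s x) (fun xt =>
    recapp_loop X alpha unbiased n' t.+1 x' (proj X (v - a^-1 *: (s - xt)))))
  else Ret x.

Definition recapp (X : set vec) (alpha : nat -> R)
    (unbiased : vec -> vec -> prog vec) (T : nat) : prog vec :=
  WarmStart (fun x0 => recapp_loop X alpha unbiased T 0 x0 x0).

Definition call_unbiased (s xprev : vec) : prog vec :=
  UnbiasedProx s xprev (Ret).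

(* Returns [:: x^(0); ...; x^(n)], where x^(0) = x. *)
Fixpoint approx_prox_seq (s x : vec) (n : nat) : prog (seq vec) :=
  if n is n'.+1 then
    ApproxProx s x x (fun x' =>
    bind (approx_prox_seq s x' n') (fun xs => Ret (x :: xs)))
  else Ret [:: x].

Definition mlmc (p : R) (j0 : nat) (s xprev : vec) : prog vec :=
  ApproxProx s s xprev (fun x0 =>
  Geometric p (fun k =>
  let J := (j0 + k)%N in
  let pJ := (1 - p) * p ^+ k in
  bind (approx_prox_seq s x0 J) (fun xs =>
  Ret (xs`_j0 + pJ^-1 *: (xs`_J - xs`_(maxn J.-1 j0)))))).

End algorithms.

(* Main.v *)
Require Import Defs.
From HB Require Import structures.
From mathcomp Require Import all_boot all_order all_algebra.
From mathcomp Require Import all_classical all_reals all_analysis.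
From mathcomp Require Import measurable_realfun ring lra.
Set Implicit Arguments.
Unset Strict Implicit.
Unset Printing Implicit Defensive.
Import Order.TTheory GRing.Theory Num.Theory numFieldNormedType.Exports.
Local Open Scope classical_set_scope.
Local Open Scope ring_scope.

(** Why the theorem holds. Let y minimize F over X, let z = prox(s) be the exact
    proximal point of an iteration, and follow the potential
      alpha_t^-2 (F(x_t) - F(y)) + lambda/2 |v_t - y|^2 .
    With exact answers it does not increase: combine the three-point inequality
    of the proximal point ([prox_three_point]) at x_t, with weight alpha_t^-2,
    and at y, with weight 1/alpha_(t+1); the recursion of the weights makes the
    linear terms collapse ([recapp_step_le]), and this leaves the two negative
    terms - lambda alpha_(t+1)^-2 |z - s|^2 and - alpha_t^-2 V_z(x_t) to spend.
    The errors allowed to the oracles are multiples of exactly these two quantities.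
    Projection does not move v_(t+1) away from y, so F(x_(t+1)) and a quadratic
    function of the answer of UnbiasedProx are all that has to be averaged. The
    allowed errors are paid for because alpha_(t+1) <= 5/8, which is where the
    value (sqrt 5 - 1)/2 of alpha_1 enters ([expect_recapp_loop_le]). Since
    1/alpha_t >= 1 + t/2, the gap after T iterations is O(lambda D^2 / T^2).

    The loop sees UnbiasedProx only through the mean of a quadratic function of
    its answer. The predicate [unbiased_impl] states the resulting upper bound;
    it holds of a direct call ([unbiased_impl_call]) and of MLMC
    ([unbiased_impl_mlmc]), so the loop is analyzed once for both.

    For MLMC, write phi(x) = F_s(x) - F_s(z). It dominates
    V_z(x) + lambda/2 |x - z|^2 ([excess_ge]), which is 8 times the error allowed
    to an ApproxProx call started at x, so each call divides the mean of phi by 8.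
    Hence the mean of |x^(j) - z|^2 decays like 8^-j while the factor 1/p_J of the
    estimator grows only like 2^k: the second moment is a convergent geometric
    series, and the means of the levels telescope to the limit z
    ([mlmc_series_le]). The mean number of calls in one estimate is 4.

    Two analytic points shape the proofs. Expectations of programs are nested
    integrals whose integrands need not be known to be measurable. The integral is
    nevertheless monotone on all functions ([le_integral_nonmeasurable]), so each
    integrand is replaced by an explicit bound before linearity is used, and most
    of the argument needs measurability in a single seed only. The exception is
    the telescoping in MLMC: it needs the means of successive iterates to be
    measurable functions of the current iterate, which is what joint
    measurability of the oracle provides ([bounded_borel_prox_step]). Second, the
    infinite sum over a geometric draw is meaningful only where it converges, so
    the continuation of the program is kept bounded ([expect_bounded],
    [geometric_mean]). *)

(** * Euclidean geometry *)

Section euclid.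
Context (R : realType) (d : nat).
Implicit Types (u v w : 'rV[R]_d) (a : R).

Lemma dotvC u v : dotv u v = dotv v u.
Proof. by apply: eq_bigr => i _; rewrite mulrC. Qed.

Lemma dotvDl u v w : dotv (u + v) w = dotv u w + dotv v w.
Proof. by rewrite -big_split; apply: eq_bigr => i _; rewrite mxE mulrDl. Qed.

Lemma dotvDr u v w : dotv w (u + v) = dotv w u + dotv w v.
Proof. by rewrite dotvC dotvDl !(dotvC _ w). Qed.

Lemma dotvZl a u v : dotv (a *: u) v = a * dotv u v.
Proof. by rewrite mulr_sumr; apply: eq_bigr => i _; rewrite mxE mulrA. Qed.

Lemma dotvZr a u v : dotv u (a *: v) = a * dotv u v.
Proof. by rewrite dotvC dotvZl dotvC. Qed.

Lemma dotvNl u v : dotv (- u) v = - dotv u v.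
Proof. by rewrite -scaleN1r dotvZl mulN1r. Qed.

Lemma dotvNr u v : dotv u (- v) = - dotv u v.
Proof. by rewrite dotvC dotvNl dotvC. Qed.

Lemma dotv_ge0 u : 0 <= dotv u u.
Proof. by apply: sumr_ge0 => i _; rewrite -expr2 sqr_ge0. Qed.

Lemma enorm_ge0 u : 0 <= enorm u.
Proof. exact: sqrtr_ge0. Qed.

Lemma sqr_enorm u : enorm u ^+ 2 = dotv u u.
Proof. by rewrite sqr_sqrtr ?dotv_ge0. Qed.

Definition dotvE := (dotvDl, dotvDr, dotvZl, dotvZr, dotvNl, dotvNr).

Lemma sqr_enormD u v :
  enorm (u + v) ^+ 2 = enorm u ^+ 2 + 2 * dotv u v + enorm v ^+ 2.
Proof. by rewrite !sqr_enorm !dotvE (dotvC v u); ring. Qed.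

Lemma sqr_enormZ a u : enorm (a *: u) ^+ 2 = a ^+ 2 * enorm u ^+ 2.
Proof. by rewrite !sqr_enorm !dotvE; ring. Qed.

Lemma sqr_enormN u : enorm (- u) ^+ 2 = enorm u ^+ 2.
Proof. by rewrite !sqr_enorm !dotvE; ring. Qed.

Lemma sqr_enorm_distC u v : enorm (u - v) ^+ 2 = enorm (v - u) ^+ 2.
Proof. by rewrite -sqr_enormN opprB. Qed.

(** The difference of the two sides is |u - v|^2. *)
Lemma sqr_enormD_le u v :
  enorm (u + v) ^+ 2 <= 2 * enorm u ^+ 2 + 2 * enorm v ^+ 2.
Proof.
have := sqr_ge0 (enorm (u - v)).
by rewrite !sqr_enormD sqr_enormN dotvNr; lra.
Qed.

(** The topology of row vectors is that of the sup norm; this comparison turns a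
    Euclidean diameter into boundedness. *)
Lemma normr_le_enorm u : `|u| <= enorm u.
Proof.
rewrite {1}/Num.norm /= mx_normrE; apply/bigmax_leP; split => [|[i j] _ /=].
  exact: enorm_ge0.
rewrite ord1 -sqrtr_sqr ler_sqrt ?dotv_ge0// /dotv (bigD1 j)//= -expr2 lerDl.
by apply: sumr_ge0 => k _; rewrite -expr2 sqr_ge0.
Qed.

End euclid.

Section euclid_continuity.
Context (R : realType) (d : nat).

Lemma cvg_dotv (T : Type) (A : set_system T) {FA : Filter A}
    (f g : T -> 'rV[R]_d) u v :
  f @ A --> u -> g @ A --> v -> dotv (f x) (g x) @[x --> A] --> dotv u v.
Proof.
move=> fu gv; rewrite /dotv; elim: (index_enum _) => [|i r IHr].
  by rewrite big_nil; under eq_fun do rewrite big_nil; exact: cvg_cst.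
rewrite big_cons; under eq_fun do rewrite big_cons.
have coordE w : {for w, continuous (fun M : 'rV[R]_d => M 0 i)}.
  exact: coord_continuous.
apply: cvgD => //; apply: cvgM.
  exact: (cvg_comp _ _ fu (coordE u)).
exact: (cvg_comp _ _ gv (coordE v)).
Qed.

Lemma continuous_subr_cst (z : 'rV[R]_d) : continuous (fun x : 'rV[R]_d => x - z).
Proof.
move=> x; apply: (@cvgB _ _ _ (nbhs x) _ id (fun=> z)); first exact: cvg_id.
exact: cvg_cst.
Qed.

Lemma continuous_dotvB (b z : 'rV[R]_d) :
  continuous (fun x : 'rV[R]_d => dotv b (x - z)).
Proof.
move=> x; apply: (@cvg_dotv _ (nbhs x) _ (fun=> b) (fun y => y - z)).
  exact: cvg_cst.
exact: continuous_subr_cst.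
Qed.

Lemma continuous_sqr_enormB (z : 'rV[R]_d) :
  continuous (fun x : 'rV[R]_d => enorm (x - z) ^+ 2).
Proof.
move=> x; under eq_fun do rewrite sqr_enorm.
by apply: (@cvg_dotv _ (nbhs x)); exact: continuous_subr_cst.
Qed.

Lemma continuous_enormB (z : 'rV[R]_d) :
  continuous (fun x : 'rV[R]_d => enorm (x - z)).
Proof.
move=> x.
apply: (@continuous_comp _ _ _ (fun y : 'rV[R]_d => dotv (y - z) (y - z)) Num.sqrt).
  by apply: (@cvg_dotv _ (nbhs x)); exact: continuous_subr_cst.
exact: sqrt_continuous.
Qed.

End euclid_continuity.

(** * Convex bodies, Bregman divergences and proximal points *)

Section convex_body.
Context (R : realType) (d : nat) (X : set 'rV[R]_d).
Hypothesis X0 : X !=set0.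
Hypothesis clX : closed X.
Hypothesis cvX : convex_set (X : set (convex_lmodType 'rV[R]_d)).

Lemma convex_set_comb (a : R) x y :
  0 <= a <= 1 -> X x -> X y -> X ((1 - a) *: x + a *: y).
Proof.
move=> /andP[a0 a1] Xx Xy.
have /set_mem := cvX (Itv01 a0 a1) (mem_set Xy) (mem_set Xx).
by rewrite /conv/= /unstable.onem addrC.
Qed.

Lemma convex_set_segment (h : R) x y :
  0 <= h <= 1 -> X x -> X y -> X (x + h *: (y - x)).
Proof.
move=> h01 Xx Xy; have := convex_set_comb h01 Xx Xy.
by rewrite scalerBl scale1r scalerBr addrAC addrA.
Qed.

Lemma bounded_diameter_compact (D : R) :
  (forall x y, X x -> X y -> enorm (x - y) <= D) -> compact X.
Proof.
move=> XD; apply: bounded_closed_compact clX; have [a Xa] := X0.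
exists (D + `|a|); split; first exact: num_real.
move=> M DM x Xx /=; have := ler_normD (x - a) a; rewrite subrK => /le_trans; apply.
apply/ltW/(le_lt_trans _ DM); rewrite lerD2r.
exact: le_trans (normr_le_enorm _) (XD _ _ Xx Xa).
Qed.

Hypothesis cptX : compact X.

Lemma argminP (f : 'rV[R]_d -> R) : {within X, continuous f} ->
  X (argmin X f) /\ forall y, X y -> f (argmin X f) <= f y.
Proof.
move=> cf; have [c /set_mem Xc cmin] := EVT_min_rV X0 cptX cf.
apply: (@getPex _ [set x | X x /\ forall y, X y -> f x <= f y]).
by exists c; split=> // y /mem_set/cmin.
Qed.

Lemma within_continuous_bounded (f : 'rV[R]_d -> R) : {within X, continuous f} ->
  exists M, forall x, X x -> `|f x| <= M.
Proof.
move=> cf; have [c _ cmin] := EVT_min_rV X0 cptX cf.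
have [e _ emax] := EVT_max_rV X0 cptX cf.
exists (`|f c| + `|f e|) => x /mem_set Xx.
have := cmin _ Xx; have := emax _ Xx.
have := ler_norm (f e); have := lerNnormlW (lexx `|f c|).
have := normr_ge0 (f c); have := normr_ge0 (f e).
by rewrite ler_norml; lra.
Qed.

(** A linear term that is nonnegative up to a quadratic one, near 0, has a
    nonnegative slope. All first-order conditions below are of this form,
    with h the step along a segment of X. *)
Lemma first_order_ge0 (del p q : R) : 0 < del ->
  (forall h, 0 < h <= 1 -> h < del -> 0 <= h * p + h ^+ 2 * q) -> 0 <= p.
Proof.
move=> del0 H; rewrite leNgt; apply/negP => p0.
have q0 : 0 < `|q| + 1 by rewrite ltr_wpDl.
(* for such a step the quadratic term is at most half of the linear one *)
pose h := Num.min (Num.min 1 (del / 2)) (- p / (2 * (`|q| + 1))).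
have h0 : 0 < h.
  by rewrite !lt_min ltr01 !divr_gt0// ?oppr_gt0// mulr_gt0.
have h1 : h <= 1 by rewrite !ge_min lexx.
have hdel : h < del.
  by rewrite !gt_min ltr_pdivrMr// ltr_pMr// ltr1n orbT.
have := H h; rewrite h0 h1 => /(_ isT hdel).
have hq : h * (2 * (`|q| + 1)) <= - p.
  by rewrite -ler_pdivlMr ?mulr_gt0// ge_min lexx orbT.
have := ler_norm q; nra.
Qed.

(** The first-order condition at the projection p says that y - p and x - p form an
    obtuse angle; then |y - x|^2 = |y - p|^2 + |p - x|^2 + 2 <y - p, p - x> gives
    the bound. *)
Lemma projP y : X (Defs.proj X y) /\ forall x, X x ->
  enorm (Defs.proj X y - x) ^+ 2 <= enorm (y - x) ^+ 2.
Proof.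
have [|Xp pmin] := @argminP (fun x : 'rV[R]_d => enorm (x - y)).
  exact/continuous_subspaceT/continuous_enormB.
split=> // x Xx; rewrite -/(Defs.proj X y) in pmin Xp *.
set p := Defs.proj X y in pmin Xp *.
have obt : 0 <= 2 * dotv (p - y) (x - p).
  apply: (@first_order_ge0 1 _ (enorm (x - p) ^+ 2) ltr01) => h /andP[h0 h1] _.
  have := pmin _ (convex_set_segment (h := h) _ Xp Xx).
  rewrite (ltW h0) h1 => /(_ isT).
  rewrite -(@ler_pXn2r _ 2) ?nnegrE ?enorm_ge0//.
  rewrite (addrAC p) (sqr_enormD (p - y)) sqr_enormZ dotvZr; lra.
have := sqr_enormD (y - p) (p - x).
rewrite addrA subrK => ->; have := sqr_ge0 (enorm (y - p)).
by move: obt; rewrite -(opprB y p) -(opprB p x) dotvNl dotvNr; lra.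
Qed.

Section objective_function.
Context (F : 'rV[R]_d -> R) (lambda : R).
Hypothesis cvF : convex_function (X : set (convex_lmodType 'rV[R]_d)) F.
Hypothesis dF : differentiable_on X F.
Hypothesis lambda0 : 0 < lambda.

Lemma convex_function_segment (h : R) x y : 0 <= h <= 1 -> X x -> X y ->
  F (x + h *: (y - x)) <= F x + h * (F y - F x).
Proof.
move=> /andP[h0 h1] Xx Xy.
have := cvF (Itv01 h0 h1) (mem_set Xy) (mem_set Xx).
rewrite convRE /conv/= /unstable.onem => H; apply: le_trans (le_trans H _); last by lra.
by rewrite scalerBr addrCA scalerBl scale1r.
Qed.

Local Notation dFat z := ('d (F : 'rV[R]_d -> R^o) (within X (nbhs z))).

(** Unfolds differentiability along the trace of the neighborhoods on X. The limit
    point of that filter is z because X meets every neighborhood of z. *)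
Lemma diff_within_approx z : X z -> forall e, 0 < e -> exists2 del, 0 < del &
  forall y, X y -> `|y - z| < del ->
    `|F y - F z - dFat z (y - z)| <= e * `|y - z|.
Proof.
move=> Xz e e0.
have PF : ProperFilter (within X (nbhs z)).
  apply: within_nbhs_proper; exact: subset_closure.
have limz : lim (within X (nbhs z)) = z.
  exact: (@cvg_lim _ (@norm_hausdorff _ _) _ _ PF id z (cvg_within X)).
have [[_ dE]] := dF Xz.
have /eqaddoP/(_ e e0) := dE.
rewrite limz => /= H.
have {H} := H; rewrite near_withinE => /nbhs_normP[del del0 H]; exists del => //.
move=> y Xy zy; have := H y; rewrite /ball_/= distrC => /(_ zy Xy).
by rewrite !fctE /= opprD addrA.
Qed.

Lemma differentiable_within_continuous : {within X, continuous F}.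
Proof.
apply/subspace_continuousP => z Xz; apply/cvgrPdist_le => e e0.
have [K K0 KP] : exists2 K, 0 < K & forall w, `|dFat z w| <= K * `|w|.
  have [[dc _]] := dF Xz.
  have /linear_bounded_continuous/linear_boundedP/pinfty_ex_gt0[K K0 KP] := dc.
  by exists K.
have [del del0 H] := diff_within_approx Xz ltr01.
have K10 : 0 < K + 1 by rewrite ltr_wpDr.
have eps0 : 0 < Num.min del (e / (K + 1)) by rewrite lt_min del0 divr_gt0.
have /cvgrPdist_lt/(_ _ eps0) zy : id @ within X (nbhs z) --> z.
  exact: cvg_within_filter.
near=> y.
have Xy : X y by near: y; exact: withinT.
have : `|y - z| < Num.min del (e / (K + 1)) by rewrite distrC; near: y.
rewrite lt_min ltr_pdivlMr// => /andP[yd].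
rewrite mulrDr mulr1 => ye.
have := H y Xy yd; rewrite mul1r => Hy.
have := ler_normD (F y - F z - dFat z (y - z)) (dFat z (y - z)).
rewrite subrK distrC => Hs; have := KP (y - z); lra.
Unshelve. all: by end_near. Qed.

Lemma directional_approx z w (e : R) : X z -> X (z + w) -> 0 < e ->
  exists2 del, 0 < del &
  forall h, 0 < h <= 1 -> h < del ->
    `|F (z + h *: w) - F z - h * dFat z w| <= e * h.
Proof.
move=> Xz Xw e0.
have w0 : 0 < `|w| + 1 by rewrite ltr_wpDl.
have [del del0 H] := diff_within_approx Xz (divr_gt0 e0 w0).
exists (del / (`|w| + 1)); first exact: divr_gt0.
move=> h /andP[h0 h1]; rewrite ltr_pdivlMr// => hdel.
have Xh : X (z + h *: w).
  have := @convex_set_segment h z (z + w).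
  by rewrite (addrAC z) subrr add0r (ltW h0) h1; exact.
have := H _ Xh; rewrite (addrAC z) subrr add0r normrZ (gtr0_norm h0) linearZ.
have -> : h * `|w| < del.
  by rewrite (le_lt_trans _ hdel)// ler_wpM2l ?lerDl// ltW.
move=> /(_ erefl) /le_trans; apply.
rewrite mulrCA -mulrA [e * h]mulrC ler_pM2l// ler_piMr ?(ltW e0)//.
by rewrite mulrC ler_pdivrMr// mul1r lerDl.
Qed.

(** Gradient inequality: convexity bounds the difference quotients of F along the
    segment from z to y by F(y) - F(z), and they tend to the differential. *)
Lemma breg_ge0 z y : X z -> X y -> 0 <= breg X F z y.
Proof.
move=> Xz Xy; rewrite /breg; apply/ler_addgt0Pr => e e0.
have [|del del0 H] := @directional_approx z (y - z) e Xz _ e0.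
  by rewrite addrCA subrr addr0.
apply: (@first_order_ge0 del _ 0 del0) => h h01 hdel.
have := H h h01 hdel; rewrite ler_norml => /andP[He _].
case/andP: h01 => h0 h1.
have := convex_function_segment (h := h) _ Xz Xy.
by rewrite (ltW h0) h1 => /(_ isT); lra.
Qed.

Local Notation prx s := (prox X F lambda s).

Lemma regularized_continuous s : {within X, continuous (regularized F lambda s)}.
Proof.
apply/subspace_continuousP => x Xx; apply: cvgD.
  exact: (subspace_continuousP _ _).1 differentiable_within_continuous _ Xx.
apply: cvg_within_filter; apply: cvgM; first exact: cvg_cst.
exact: continuous_sqr_enormB.
Qed.

Lemma prox_in s : X (prx s).
Proof. exact: (argminP (@regularized_continuous s)).1. Qed.

(** Variational inequality of the minimizer of F_s, again by difference quotients;
    the quadratic term of F_s is of second order along the segment. *)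
Lemma prox_first_order s y : X s -> X y ->
  0 <= dFat (prx s) (y - prx s)
       + lambda * dotv (prx s - s) (y - prx s).
Proof.
move=> Xs Xy; have [Xz zmin] := argminP (@regularized_continuous s).
rewrite -/(prx s) in Xz zmin; set z := prx s in Xz zmin *.
apply/ler_addgt0Pr => e e0.
have [|del del0 H] := @directional_approx z (y - z) e Xz _ e0.
  by rewrite addrCA subrr addr0.
set p := dFat z (y - z) in H *; set q := dotv (z - s) (y - z).
set w2 := enorm (y - z) ^+ 2.
have w20 : 0 <= w2 by exact: sqr_ge0.
apply: (@first_order_ge0 del _ (lambda / 2 * w2) del0) => h h01 hdel.
have := H h h01 hdel; rewrite ler_norml => /andP[_ He].
case/andP: h01 => h0 h1.
have := zmin _ (convex_set_segment (h := h) _ Xz Xy); rewrite (ltW h0) h1.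
move=> /(_ isT); rewrite /regularized (addrAC z) (sqr_enormD (z - s)).
rewrite sqr_enormZ dotvZr -/q -/w2; lra.
Qed.

(** Optimality of the proximal point, rewritten by exchanging the differential of F
    for the Bregman divergence. *)
Lemma prox_three_point s y : X s -> X y ->
  F (prx s) <= F y + lambda * dotv (prx s - s) (y - prx s) - breg X F (prx s) y.
Proof. by move=> Xs Xy; have := prox_first_order Xs Xy; rewrite /breg; lra. Qed.

(** Suboptimality in the proximal problem. It is the quantity that ApproxProx
    controls, and it contracts when calls are chained. *)
Definition prox_excess s x := regularized F lambda s x - regularized F lambda s (prx s).

(** The strong convexity of F_s, keeping the Bregman divergence of F: the left side is
    the error scale of ApproxProx started from x. *)
Lemma excess_ge s x : X s -> X x ->
  breg X F (prx s) x + lambda / 2 * enorm (x - prx s) ^+ 2 <= prox_excess s x.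
Proof.
move=> Xs Xx; have := prox_three_point Xs Xx; rewrite /prox_excess /regularized.
have := sqr_enormD (prx s - s) (x - prx s).
rewrite [prx s - s + _]addrC addrA subrK => ->; lra.
Qed.

Lemma le_excess s x : X s -> X x ->
  lambda / 2 * enorm (x - prx s) ^+ 2 <= prox_excess s x.
Proof.
by move=> Xs Xx; have := excess_ge Xs Xx; have := breg_ge0 (prox_in s) Xx; lra.
Qed.

(** ApproxProx bounds F_s and not F. The difference lambda/2 |x - s|^2 is not dropped:
    |z - s|^2 <= 2 |x - s|^2 + 2 |x - z|^2, where |x - z|^2 costs one more excess,
    and the resulting negative multiple of |z - s|^2 is needed in the potential. *)
Lemma objective_le_excess s x : X s -> X x ->
  F x <= 2 * prox_excess s x + regularized F lambda s (prx s)
         - lambda / 4 * enorm (prx s - s) ^+ 2.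
Proof.
move=> Xs Xx; have := le_excess Xs Xx; rewrite /prox_excess /regularized.
have := sqr_enormD_le (x - s) (prx s - x).
rewrite [x - s + _]addrC addrA subrK (sqr_enorm_distC _ x).
move=> /(ler_wpM2l (ltW lambda0)); lra.
Qed.

End objective_function.

End convex_body.

(** * Integrals over a probability space *)

Section integral_toolbox.
Context d (T : measurableType d) (R : realType).
Local Open Scope ereal_scope.

(** The integral is the difference of two suprema over simple functions below the
    positive and the negative part, and each supremum is monotone in the function.
    So nested expectations can be bounded from the inside out without showing
    that the inner ones are measurable. *)
Lemma le_integral_nonmeasurable (mu : {measure set T -> \bar R}) (f g : T -> \bar R) :
  (forall x, f x <= g x) -> \int[mu]_x f x <= \int[mu]_x g x.
Proof.
move=> fg.
have ge0_le (h k : T -> \bar R) : (forall x, 0 <= h x) -> (forall x, h x <= k x) ->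
    \int[mu]_x h x <= \int[mu]_x k x.
  move=> h0 hk; rewrite !ge0_integralE//; last by move=> x _; exact: le_trans (hk x).
  rewrite !patch_setT; apply: le_ereal_sup => _ [n nh <-]; exists n => // x.
  exact: le_trans (nh x) (hk x).
rewrite integralE [leRHS]integralE leeB//; apply: ge0_le => // x.
  by apply: (@funepos_le _ _ setT) => //; rewrite inE.
by apply: (@funeneg_le _ _ setT) => //; rewrite inE.
Qed.

Variable P : probability T R.

Lemma expectation_const (r : R) : \int[P]_x r%:E = r%:E.
Proof. rewrite integral_cst//; transitivity (r%:E * 1); last by rewrite mule1.
by congr (_ * _); exact: probability_setT.
Qed.

Lemma expectation_le (f : T -> \bar R) (r : R) :
  (forall x, f x <= r%:E) -> \int[P]_x f x <= r%:E.
Proof.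
by move=> fr; rewrite -(expectation_const r); exact: le_integral_nonmeasurable.
Qed.

Lemma expectation_ge (f : T -> \bar R) (r : R) :
  (forall x, r%:E <= f x) -> r%:E <= \int[P]_x f x.
Proof.
by move=> fr; rewrite -(expectation_const r); exact: le_integral_nonmeasurable.
Qed.

Lemma integrable_const (r : R) : P.-integrable setT (EFin \o (fun=> r)).
Proof. exact: finite_measure_integrable_cst. Qed.

Lemma bounded_integrable (f : T -> R) (M : R) : measurable_fun setT f ->
  (forall x, `|f x| <= M)%R -> P.-integrable setT (EFin \o f).
Proof.
move=> mf fM; apply: measurable_bounded_integrable => //.
  by rewrite -ge0_fin_numE// fin_num_measure.
by exists M; split=> [|y My x _]; [exact: num_real|exact: le_trans (fM x) (ltW My)].
Qed.

Lemma integrable_affine (a c : R) (f : T -> R) : P.-integrable setT (EFin \o f) ->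
  P.-integrable setT (EFin \o (fun x => a + c * f x)%R).
Proof.
move=> intf; rewrite [X in integrable _ _ X](_ : _ =
  (EFin \o (fun=> a)) \+ (fun x => c%:E * (EFin \o f) x)).
  apply: integrableD => //; first exact: integrable_const.
  exact: integrableZl.
by apply/funext => x /=; rewrite EFinD EFinM.
Qed.

Lemma expectation_affine (a c : R) (f : T -> R) : P.-integrable setT (EFin \o f) ->
  \int[P]_x (a + c * f x)%:E = a%:E + c%:E * \int[P]_x (f x)%:E.
Proof.
move=> intf; under eq_integral do rewrite EFinD EFinM.
rewrite integralD//; first last.
- by apply: integrableZl.
- exact: integrable_const.
by rewrite expectation_const integralZl.
Qed.

End integral_toolbox.

(** * Programs and geometric draws *)

Section programs.
Context (R : realType) (d : nat).
Local Notation vec := 'rV[R]_d.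
Local Notation prog := (prog R d).
Context (OW : oracle R d unit) (OA : oracle R d (vec * vec * vec))
  (OU : oracle R d (vec * vec)).
Local Notation expect := (expect OW OA OU).
Local Notation surely := (surely OW OA OU).

Lemma add_calls0 (A : Type) (f : calls -> A) : f \o add_calls (Calls 0 0 0) = f.
Proof. by apply/funext => -[]. Qed.

Lemma add_callsA (A : Type) (f : calls -> A) c c' :
  (f \o add_calls c) \o add_calls c' = f \o add_calls (add_calls c c').
Proof. by apply/funext => e; rewrite /= /add_calls/= !addnA. Qed.

Lemma expect_bind (A B : Type) (m : prog A) (h : A -> prog B)
    (f : calls -> B -> \bar R) :
  expect (bind m h) f = expect m (fun c a => expect (h a) (f \o add_calls c)).
Proof.
elim: m f => [a|k IH|s xi xp k IH|s xp k IH|p k IH] f /=.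
- by rewrite add_calls0.
- by apply: eq_integral => u _; rewrite IH; congr expect;
    apply/funext => c; apply/funext => a /=; rewrite add_callsA.
- by apply: eq_integral => u _; rewrite IH; congr expect;
    apply/funext => c; apply/funext => a /=; rewrite add_callsA.
- by apply: eq_integral => u _; rewrite IH; congr expect;
    apply/funext => c; apply/funext => a /=; rewrite add_callsA.
- by apply: eq_eseriesr => n _; rewrite IH.
Qed.

Lemma surely_bind (A B : Type) (m : prog A) (h : A -> prog B)
    (P : calls -> B -> Prop) :
  surely (bind m h) P = surely m (fun c a => surely (h a) (P \o add_calls c)).
Proof.
elim: m P => [a|k IH|s xi xp k IH|s xp k IH|p k IH] P /=.
- by rewrite add_calls0.
- by apply: eq_forall => u; rewrite IH; congr surely;
    apply/funext => c; apply/funext => a /=; rewrite add_callsA.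
- by apply: eq_forall => u; rewrite IH; congr surely;
    apply/funext => c; apply/funext => a /=; rewrite add_callsA.
- by apply: eq_forall => u; rewrite IH; congr surely;
    apply/funext => c; apply/funext => a /=; rewrite add_callsA.
- by apply: eq_forall => n; rewrite IH.
Qed.

Lemma surely_sub (A : Type) (m : prog A) (P Q : calls -> A -> Prop) :
  (forall c a, P c a -> Q c a) -> surely m P -> surely m Q.
Proof.
elim: m P Q => [a|k IH|s xi xp k IH|s xp k IH|p k IH] P Q /= PQ.
- exact: PQ.
- by move=> H u; apply: IH (H u) => c a; exact: PQ.
- by move=> H u; apply: IH (H u) => c a; exact: PQ.
- by move=> H u; apply: IH (H u) => c a; exact: PQ.
- by move=> H n; apply: IH (H n).
Qed.

Lemma surelyT (A : Type) (m : prog A) (P : calls -> A -> Prop) :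
  (forall c a, P c a) -> surely m P.
Proof.
elim: m P => [a|k IH|s xi xp k IH|s xp k IH|p k IH] P /= HP // u;
  by apply: IH => c a; exact: HP.
Qed.

Section geometric_mean.
Context (p : R).
Hypothesis p01 : 0 <= p < 1.

Lemma geometric_weight_ge0 n : 0 <= (1 - p) * p ^+ n.
Proof.
by case/andP: p01 => p0 p1; rewrite mulr_ge0 ?exprn_ge0// subr_ge0 ltW.
Qed.

Lemma geometric_weight_series : series (fun n => (1 - p) * p ^+ n) @ \oo --> (1 : R).
Proof.
case/andP: p01 => p0 p1.
have := @cvg_geometric_series R (1 - p) p; rewrite ger0_norm// => /(_ p1).
by rewrite divff// subr_eq0 gt_eqF.
Qed.

(** Values bounded by M make the series of a geometric mean absolutely convergent.
    Without convergence the infinite sum would be an arbitrary value, and no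
    comparison of terms would say anything about it. *)
Lemma geometric_mean (e : nat -> \bar R) (M : R) :
  (forall n, `|e n| <= M%:E)%E ->
  exists r : nat -> R, exists l : R,
  [/\ forall n, e n = (r n)%:E,
      series (fun n => (1 - p) * p ^+ n * r n) @ \oo --> l
    & (\sum_(0 <= n <oo) (((1 - p) * p ^+ n)%:E * e n) = l%:E)%E].
Proof.
move=> eM; have efin n : e n \is a fin_num.
  by rewrite fin_num_abs (le_lt_trans (eM n))// ltry.
pose r n := fine (e n); have er n : e n = (r n)%:E by rewrite /r fineK.
have rM n : `|r n| <= M by rewrite -lee_fin; have := eM n; rewrite er.
have : cvgn (series (fun n => (1 - p) * p ^+ n * r n)).
  have p1 : `|p| < 1 by case/andP: p01 => p0 p1; rewrite ger0_norm.
  have M0 : 0 <= M by rewrite (le_trans _ (rM 0%N)).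
  apply: normed_cvg; apply: (@series_le_cvg _ _ (geometric (M * (1 - p)) p)).
  - by move=> n /=; exact: normr_ge0.
  - by move=> n /=; rewrite -mulrA mulr_ge0 ?geometric_weight_ge0.
  - move=> n /=; rewrite normrM ger0_norm ?geometric_weight_ge0// mulrC -mulrA.
    by rewrite ler_wpM2r ?geometric_weight_ge0.
  - exact: is_cvg_geometric_series.
move=> /cvg_ex[l rl]; exists r, l; split=> //.
under eq_eseriesr do rewrite er -EFinM.
apply: cvg_lim => //.
rewrite (_ : (fun _ => _) = EFin \o series (fun n => (1 - p) * p ^+ n * r n)).
  exact: (cvg_comp _ _ rl).
by apply/funext => N; rewrite /series/= sumEFin.
Qed.

End geometric_mean.

Fixpoint proper_draws (A : Type) (m : prog A) : Prop :=
  match m with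
  | Ret _ => True
  | WarmStart k => forall x, proper_draws (k x)
  | ApproxProx _ _ _ k => forall x, proper_draws (k x)
  | UnbiasedProx _ _ k => forall x, proper_draws (k x)
  | Geometric p k => 0 <= p < 1 /\ forall n, proper_draws (k n)
  end.

Lemma proper_draws_bind (A B : Type) (m : prog A) (h : A -> prog B) :
  proper_draws m -> (forall a, proper_draws (h a)) -> proper_draws (bind m h).
Proof.
move=> + H; elim: m => [a|k IH|s xi xp k IH|s xp k IH|p k IH] /=.
- by move=> _; exact: H.
- by move=> Hk x; apply: IH.
- by move=> Hk x; apply: IH.
- by move=> Hk x; apply: IH.
- by move=> [p01 Hk]; split=> // n; exact: IH.
Qed.

(** Boundedness is what a geometric draw needs of the rest of the program; here it
    follows from a bound on the outputs that can occur. *)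
Lemma expect_bounded (A : Type) (m : prog A) (f : calls -> A -> \bar R) (M : R) :
  proper_draws m -> surely m (fun c a => (`|f c a| <= M%:E)%E) ->
  (`|expect m f| <= M%:E)%E.
Proof.
have mean dd (T : measurableType dd) (P : probability T R) (g : T -> \bar R) :
    (forall u, `|g u| <= M%:E)%E -> (`|\int[P]_u g u| <= M%:E)%E.
  move=> gM; have gfin u : g u \is a fin_num.
    by rewrite fin_num_abs (le_lt_trans (gM u))// ltry.
  have gM' u : (- M <= fine (g u) <= M)%R.
    by rewrite -ler_norml -lee_fin; have := gM u; rewrite -{1}(fineK (gfin u)).
  have le1 : (\int[P]_u g u <= M%:E)%E.
    by apply: expectation_le => u; rewrite -(fineK (gfin u)) lee_fin; case/andP: (gM' u).
  have le2 : ((- M)%:E <= \int[P]_u g u)%E.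
    by apply: expectation_ge => u; rewrite -(fineK (gfin u)) lee_fin; case/andP: (gM' u).
  by case: (\int[P]_u g u)%E le1 le2 => [l| |] //=; rewrite !lee_fin ler_norml => -> ->.
elim: m f => [a|k IH|s xi xp k IH|s xp k IH|p k IH] f //=.
- by move=> Hk H; apply: mean => u; exact: IH.
- by move=> Hk H; apply: mean => u; exact: IH.
- by move=> Hk H; apply: mean => u; exact: IH.
- move=> [p01 Hk] H.
  have eM n : (`|expect (k n) f| <= M%:E)%E by exact: IH.
  have [r [l [er rl ->]]] := geometric_mean p01 eM.
  have rM n : `|r n| <= M by rewrite -lee_fin; have := eM n; rewrite er.
  have Mw : M * series (fun n => (1 - p) * p ^+ n) N @[N --> \oo] --> M.
    by rewrite -[X in _ --> X]mulr1; apply: cvgMl_tmp; exact: geometric_weight_series.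
  rewrite /= lee_fin; apply: (ler_cvg_to (cvg_norm rl) Mw).
  apply: nearW => N; rewrite /series/= mulr_sumr (le_trans (ler_norm_sum _ _ _))//.
  apply: ler_sum => n _.
  rewrite normrM ger0_norm ?geometric_weight_ge0// mulrC.
  by rewrite ler_wpM2r ?geometric_weight_ge0.
Qed.

End programs.

(** * Measurability of the answers *)

Section borel_measurability.
Context (R : realType) (d : nat).
Local Notation vec := 'rV[R]_d.
Local Notation bvec := (borelV R d).

Lemma closed_borel_measurable (A : set vec) : closed A -> measurable (A : set bvec).
Proof.
move=> clA; rewrite -[A]setCK; apply: measurableC.
by apply: sub_sigma_algebra; rewrite openC.
Qed.

(** As X is closed, the preimages in X of closed half-lines are closed in the whole
    space, hence Borel. *)
Lemma within_continuous_measurable (X : set vec) (g : vec -> R) : closed X ->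
  {within X, continuous g} -> measurable_fun (X : set bvec) (g : bvec -> R).
Proof.
move=> clX cg; apply: (measurability _ (RGenCInfty.measurableE R)).
move=> _ [_ [a ->] <-].
apply: closed_borel_measurable.
have cI : closed `[a, +oo[%classic by exact: interval_closed.
have /continuous_closedP/(_ _ cI) := cg.
by rewrite -(closed_setSI _ clX).
Qed.

Lemma continuous_borel_measurable (g : vec -> R) : continuous g ->
  measurable_fun setT (g : bvec -> R).
Proof.
move=> cg; apply: within_continuous_measurable; first exact: closedT.
exact: continuous_subspaceT.
Qed.

Lemma measurable_section d1 d2 d3 (T1 : measurableType d1) (T2 : measurableType d2)
    (T3 : measurableType d3) (D : set (T1 * T2)) (f : T1 * T2 -> T3) x :
  measurable D -> measurable_fun D f -> (forall u, D (x, u)) ->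
  measurable_fun setT (fun u => f (x, u)).
Proof.
move=> mD mf Dx; apply: (measurable_comp mD _ mf); last exact: pair1_measurable.
by move=> _ [u _ <-].
Qed.

End borel_measurability.

Section oracle_sections.
Context (R : realType) (d : nat) (X : set 'rV[R]_d) (F : 'rV[R]_d -> R) (lambda : R).
Local Notation vec := 'rV[R]_d.
Local Notation bvec := (borelV R d).
Hypothesis clX : closed X.

Lemma unbiased_section_measurable (OU : oracle R d (vec * vec)) s xp :
  is_UnbiasedProx X F lambda OU -> X s -> X xp ->
  measurable_fun setT (fun u : seed OU => answer (s, xp) u : bvec).
Proof.
move=> [mO _ _] Xs Xxp.
apply: (measurable_section (x := (s, xp) : (bvec * bvec)) _ mO) => //.
have mX := closed_borel_measurable clX.
rewrite (_ : [set _ | _] =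
  ((X : set bvec) `*` (X : set bvec)) `*` (setT : set (seed OU))).
  by apply: measurableX => //; exact: measurableX.
by apply/seteqP; split=> -[[a b] u] /=; tauto.
Qed.

Variable OA : oracle R d (vec * vec * vec).
Hypothesis HA : is_ApproxProx X F lambda OA.

Lemma approx_domain_measurable :
  measurable ([set z | [/\ X z.1.1.1, X z.1.1.2 & X z.1.2]]
    : set (bvec * bvec * bvec * seed OA)).
Proof.
have mX := closed_borel_measurable clX.
rewrite (_ : [set _ | _] = ((X : set bvec) `*` (X : set bvec) `*` (X : set bvec))
   `*` (setT : set (seed OA))).
  by apply: measurableX => //; apply: measurableX => //; exact: measurableX.
by apply/seteqP; split=> -[[[a b] c] u] /= => [[]|[[[]]]].
Qed.

Lemma approx_section_measurable s xi xp : X s -> X xi -> X xp ->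
  measurable_fun setT (fun u : seed OA => answer (s, xi, xp) u : bvec).
Proof.
move=> Xs Xxi Xxp; case: HA => mO _ _.
by apply: (measurable_section (x := (s, xi, xp) : (bvec * bvec * bvec))
  approx_domain_measurable mO).
Qed.

Lemma approx_in s xi xp u : X s -> X xi -> X xp -> X (@answer _ _ _ OA (s, xi, xp) u).
Proof. by case: HA => _ H _ Xs Xxi Xxp; exact: H. Qed.

(** Test functions on X for which every mean below is finite; this class is stable
    under [prox_step]. *)
Definition bounded_borel (g : vec -> R) :=
  measurable_fun (X : set bvec) (g : bvec -> R) /\
  exists M, forall x, X x -> `|g x| <= M.

Lemma bounded_borel_const c : bounded_borel (fun=> c).
Proof. by split; [exact: measurable_cst|exists `|c|]. Qed.

Lemma bounded_borelD g h :
  bounded_borel g -> bounded_borel h -> bounded_borel (fun x => g x + h x).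
Proof.
move=> [mg [M gM]] [mh [N hN]]; split; first exact: measurable_funD.
exists (M + N) => x Xx; apply: le_trans (ler_normD _ _) _.
by rewrite lerD ?gM ?hN.
Qed.

Lemma bounded_borelZ a g : bounded_borel g -> bounded_borel (fun x => a * g x).
Proof.
move=> [mg [M gM]]; split; first exact: measurable_funM.
by exists (`|a| * M) => x Xx; rewrite normrM ler_wpM2l ?gM.
Qed.

Lemma bounded_borel_integrable g s xi xp : bounded_borel g -> X s -> X xi -> X xp ->
  (seed_law OA).-integrable setT
    (EFin \o (fun u => g (@answer _ _ _ OA (s, xi, xp) u))).
Proof.
move=> [mg [M gM]] Xs Xxi Xxp; apply: (@bounded_integrable _ _ _ _ _ M).
  apply: (measurable_comp _ _ mg (approx_section_measurable Xs Xxi Xxp)).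
    exact: closed_borel_measurable.
  by move=> _ [u _ <-]; exact: approx_in.
by move=> u; apply: gM; exact: approx_in.
Qed.

(** Transition operator of the Markov chain whose step from x is the answer of
    ApproxProx to (s, x, x); its i-th iterate applied to g is the mean of g after i
    steps, as a function of the starting point. *)
Definition prox_step (s : vec) (g : vec -> R) (x : vec) : R :=
  fine (\int[seed_law OA]_u (g (@answer _ _ _ OA (s, x, x) u))%:E).

Lemma prox_stepE s g x : bounded_borel g -> X s -> X x ->
  (\int[seed_law OA]_u (g (@answer _ _ _ OA (s, x, x) u))%:E = (prox_step s g x)%:E)%E.
Proof.
move=> ng Xs Xx; rewrite fineK//.
exact: (integrable_fin_num _ (bounded_borel_integrable ng Xs Xx Xx)).
Qed.

Lemma prox_step_le s g h x : bounded_borel g -> bounded_borel h -> X s -> X x ->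
  (forall y, X y -> g y <= h y) -> prox_step s g x <= prox_step s h x.
Proof.
move=> ng nh Xs Xx gh; rewrite -lee_fin -!prox_stepE//.
by apply: le_integral_nonmeasurable => u; rewrite lee_fin gh//; exact: approx_in.
Qed.

Lemma prox_step_const s c x : prox_step s (fun=> c) x = c.
Proof. by rewrite /prox_step expectation_const. Qed.

(** Fubini-Tonelli for nonnegative functions: g is shifted by its bound M and set to 0
    off X, where the oracle is not constrained. *)
Lemma bounded_borel_prox_step s g :
  X s -> bounded_borel g -> bounded_borel (prox_step s g).
Proof.
move=> Xs ng; have [mg [M gM]] := ng; split; last first.
  exists M => x Xx; rewrite ler_norml; apply/andP; split.
    rewrite -(prox_step_const s (- M) x); apply: prox_step_le => //.
      exact: bounded_borel_const.
    by move=> y /gM; rewrite ler_norml => /andP[].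
  rewrite -(prox_step_const s M x); apply: prox_step_le => //.
    exact: bounded_borel_const.
  by move=> y /gM; rewrite ler_norml => /andP[].
have mX := closed_borel_measurable clX.
pose XT : set (bvec * seed OA) := (X : set bvec) `*` setT.
have mXT : measurable XT by exact: measurableX.
pose h0 (z : bvec * seed OA) : R := g (answer (s, z.1, z.1) z.2).
have mh0 : measurable_fun XT h0.
  apply: (measurable_comp mX _ mg).
    by move=> _ [[x u] [/= Xx _] <-]; exact: approx_in.
  case: HA => mO _ _.
  apply: (@measurable_comp _ _ _ _ _ _ _
    (fun z : bvec * bvec * bvec * seed OA => answer z.1 z.2 : bvec) _
    (fun z : bvec * seed OA => (((s : bvec), z.1, z.1), z.2))
    approx_domain_measurable _ mO).
    by move=> _ [[x u] [/= Xx _] <-].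
  apply: measurable_funTS; apply: measurable_fun_pair => //.
  by apply: measurable_fun_pair => //; exact: measurable_fun_pair.
pose h := (fun z => (h0 z + M)%:E) \_ XT.
have mh : measurable_fun setT h.
  apply/(measurable_restrictT _ mXT); apply/measurable_EFinP.
  exact: measurable_funD.
have h_ge0 z : (0 <= h z)%E.
  rewrite /h patchE; case: ifPn => // /set_mem [Xz _]; rewrite lee_fin.
  have : X (answer (s, z.1, z.1) z.2) by exact: approx_in.
  by move=> /gM; rewrite ler_norml /h0; lra.
have mF := measurable_fun_fubini_tonelli_F (m2 := seed_law OA) h mh h_ge0.
apply: (@eq_measurable_fun _ _ _ _ _ (fun x => fine (fubini_F (seed_law OA) h x) - M)).
  move=> x /set_mem Xx; rewrite /fubini_F /=.
  under eq_integral do rewrite /h patchE mem_set//= addrC -[h0 _]mul1r.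
  rewrite expectation_affine; last exact: (bounded_borel_integrable ng Xs Xx Xx).
  by rewrite prox_stepE// mul1e /= addrAC subrr add0r.
apply: measurable_funB => //; apply: measurable_funTS.
exact: (measurableT_comp (fine_measurable measurableT)).
Qed.

End oracle_sections.

(** * The multilevel estimator *)

Section mlmc_series.
Context (R : realType).

Lemma eighth_pow n : (8^-1 : R) ^+ n = (2^-1 ^+ n) ^+ 3.
Proof. by rewrite -exprM mulnC exprM; congr (_ ^+ n); rewrite exprVn -natrX. Qed.

(** The scalar content of MLMC. Read L i and A 8^-i as the mean of <b, x^(i) - z>
    and a bound on that of c |x^(i) - z|^2, and r k as the mean of the bounded
    quantity at level k. Multiplied by its probability w k, level k contributes
    L(2 + k) - L(1 + k) (nothing at k = 0), which telescopes to - L 2 and cancels the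
    term L 2 common to all levels. The quadratic part has total 2/64 + 40/64. *)
Lemma mlmc_series_le (L r : nat -> R) (K A B l : R) :
  let w k := (1 - 2^-1) * 2^-1 ^+ k in
  0 <= A -> (forall i, `|L i| <= B * 2^-1 ^+ i) ->
  (forall k, r k <= K + L 2%N + (w k)^-1 * (L (2 + k)%N - L (maxn k.+1 2))
     + A * (2 * 8^-1 ^+ 2
            + 4 * (w k) ^- 2 * (8^-1 ^+ (2 + k) + 8^-1 ^+ (maxn k.+1 2)))) ->
  series (fun k => w k * r k) @ \oo --> l ->
  l <= K + A * (42 / 64).
Proof.
move=> w A0 LB rle wrl.
have w0 k : 0 < w k.
  by rewrite /w mulr_gt0 ?exprn_gt0 ?invr_gt0// subr_gt0 invf_lt1 ?ltr1n.
pose U N := (K + L 2%N) * (1 - 2^-1 ^+ N.+1) + L (2 + N)%N - L 2%N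
  + A * (2 / 64 * (1 - 2^-1 ^+ N.+1) + (40 - 24 * (2^-1 ^+ N) ^+ 2) / 64).
have half0 : 2^-1 != 0 :> R by rewrite invr_neq0.
have wE k : w k = 2^-1 ^+ k.+1 by rewrite /w exprS; congr (_ * _); field.
(* the bounds of the levels add up to U N exactly *)
have partial N : \sum_(0 <= k < N.+1) w k * r k <= U N.
  elim: N => [|N IHN].
    rewrite big_nat1; apply: le_trans (ler_wpM2l (ltW (w0 0%N)) (rle 0%N)) _.
    rewrite (_ : maxn 1 2 = 2%N)// (_ : (2 + 0)%N = 2%N)// subrr.
    rewrite le_eqVlt; apply/orP; left; apply/eqP.
    by rewrite /U wE expr0 expr1; field.
  rewrite big_nat_recr//=.
  apply: le_trans (lerD IHN (ler_wpM2l (ltW (w0 N.+1)) (rle N.+1))) _.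
  rewrite (_ : maxn N.+2 2 = N.+2)// (_ : (2 + N.+1)%N = N.+3)//.
  rewrite le_eqVlt; apply/orP; left; apply/eqP.
  rewrite /U wE !eighth_pow (_ : (2 + N.+1)%N = N.+3)// (_ : (2 + N)%N = N.+2)//.
  have : 2^-1 ^+ N != 0 :> R by rewrite expf_neq0.
  by rewrite !exprS; set h := _ ^+ N => h0; field.
pose E := `|K + L 2%N| + `|B|.
have partial_le N : \sum_(0 <= k < N.+1) w k * r k
    <= K + A * (42 / 64) + E * 2^-1 ^+ N.
  apply: le_trans (partial N) _; rewrite /U /E.
  have := LB (2 + N)%N; rewrite (_ : (2 + N)%N = N.+2)// ler_norml => /andP[_].
  have : 0 < (2^-1 : R) ^+ N by rewrite exprn_gt0.
  rewrite !exprS; set h := _ ^+ N => h0.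
  have := ler_norm B; have := ler_norm (- (K + L 2%N)); rewrite normrN.
  have := normr_ge0 B; have := normr_ge0 (K + L 2%N); nra.
have lim_h : (2^-1 : R) ^+ N @[N --> \oo] --> 0.
  by apply: cvg_expr; rewrite ger0_norm ?invr_ge0// invf_lt1 ?ltr1n.
have limV : K + A * (42 / 64) + E * 2^-1 ^+ N @[N --> \oo] --> K + A * (42 / 64).
  rewrite -[X in _ --> X]addr0; apply: cvgD; first exact: cvg_cst.
  by rewrite -(mulr0 E); exact: cvgMl_tmp.
have wrl' : series (fun k => w k * r k) N.+1 @[N --> \oo] --> l.
  by have := wrl; rewrite -(cvg_shiftS (series (fun k => w k * r k))).
by apply: (ler_cvg_to wrl' limV); apply: nearW => N; exact: partial_le.
Qed.

End mlmc_series.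

Section mlmc_moments.
Context (R : realType) (d : nat) (X : set 'rV[R]_d) (F : 'rV[R]_d -> R) (lambda : R).
Local Notation vec := 'rV[R]_d.
Local Notation bvec := (borelV R d).
Hypothesis X0 : X !=set0.
Hypothesis clX : closed X.
Hypothesis cvX : convex_set (X : set (convex_lmodType 'rV[R]_d)).
Hypothesis cptX : compact X.
Hypothesis cvF : convex_function (X : set (convex_lmodType 'rV[R]_d)) F.
Hypothesis dF : differentiable_on X F.
Hypothesis lambda0 : 0 < lambda.
Variable OA : oracle R d (vec * vec * vec).
Hypothesis HA : is_ApproxProx X F lambda OA.

Local Notation prx s := (prox X F lambda s).
Local Notation excess := (prox_excess X F lambda).
Local Notation step := (prox_step OA).
Local Notation bounded_borel := (bounded_borel X).

Lemma bounded_borel_continuous (g : vec -> R) :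
  {within X, continuous g} -> bounded_borel g.
Proof.
move=> cg; split; first exact: within_continuous_measurable.
exact: within_continuous_bounded.
Qed.

Lemma bounded_borel_excess s : bounded_borel (excess s).
Proof.
apply: bounded_borelD; last exact: bounded_borel_const.
exact/bounded_borel_continuous/regularized_continuous.
Qed.

Lemma bounded_borel_iter_step s g i :
  X s -> bounded_borel g -> bounded_borel (iter i (step s) g).
Proof.
by move=> Xs ng; elim: i => //= i IH; exact: (bounded_borel_prox_step clX HA).
Qed.

Lemma prox_step_comb s a b g h x : bounded_borel g -> bounded_borel h -> X s -> X x ->
  step s (fun y => a * g y + b * h y) x = a * step s g x + b * step s h x.
Proof.
move=> ng nh Xs Xx; apply/eqP; rewrite -eqe; apply/eqP.
rewrite -(prox_stepE clX HA)//; last by apply: bounded_borelD; exact: bounded_borelZ.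
under eq_integral do rewrite EFinD !EFinM.
have ig := bounded_borel_integrable clX HA ng Xs Xx Xx.
have ih := bounded_borel_integrable clX HA nh Xs Xx Xx.
rewrite integralD//; [|exact: integrableZl..].
by rewrite !integralZl// !(prox_stepE clX HA).
Qed.

Lemma iter_step_comb s a b g h i x : bounded_borel g -> bounded_borel h -> X s -> X x ->
  iter i (step s) (fun y => a * g y + b * h y) x =
  a * iter i (step s) g x + b * iter i (step s) h x.
Proof.
move=> ng nh Xs; elim: i x => [//|i IH] x Xx /=.
rewrite -prox_step_comb//; [|exact: bounded_borel_iter_step..].
rewrite /prox_step; congr fine; apply: eq_integral => u _.
by rewrite IH//; exact: (approx_in HA).
Qed.

Lemma prox_step_scale s a g x : bounded_borel g -> X s -> X x ->
  step s (fun y => a * g y) x = a * step s g x.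
Proof.
move=> ng Xs Xx; have := prox_step_comb a 0 ng ng Xs Xx; rewrite mul0r addr0 => <-.
by congr (step s _ x); apply/funext => y; rewrite mul0r addr0.
Qed.

Lemma iter_step_scale s a g i x : bounded_borel g -> X s -> X x ->
  iter i (step s) (fun y => a * g y) x = a * iter i (step s) g x.
Proof.
move=> ng Xs Xx; have := iter_step_comb a 0 i ng ng Xs Xx; rewrite mul0r addr0 => <-.
by congr (iter i (step s) _ x); apply/funext => y; rewrite mul0r addr0.
Qed.

Lemma iter_step_le s g h i x : bounded_borel g -> bounded_borel h -> X s -> X x ->
  (forall y, X y -> g y <= h y) -> iter i (step s) g x <= iter i (step s) h x.
Proof.
move=> ng nh Xs Xx gh; elim: i x Xx => [|i IH] x Xx /=; first exact: gh.
apply: (prox_step_le clX HA) => //; exact: bounded_borel_iter_step.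
Qed.

Lemma iter_step_const s c i x : iter i (step s) (fun=> c) x = c.
Proof.
elim: i x => [//|i IH] x /=.
by rewrite (_ : iter i (step s) (fun=> c) = fun=> c) ?prox_step_const//; apply/funext.
Qed.

Lemma mean_excess s xi xp : X s -> X xi -> X xp ->
  (\int[seed_law OA]_u (excess s (@answer _ _ _ OA (s, xi, xp) u))%:E <=
   (8^-1 * (lambda * breg_e (prx s) xi + breg X F (prx s) xp))%:E)%E.
Proof.
move=> Xs Xxi Xxp; case: HA => _ _ /(_ _ _ _ Xs Xxi Xxp) Hm; apply: le_trans Hm.
have nreg : bounded_borel (regularized F lambda s).
  exact/bounded_borel_continuous/regularized_continuous.
have intr := bounded_borel_integrable clX HA nreg Xs Xxi Xxp.
under eq_integral do rewrite /prox_excess addrC -[X in _ + X]mul1r.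
by rewrite expectation_affine// mul1e EFinN addeC.
Qed.

Lemma prox_step_excess s x : X s -> X x ->
  step s (excess s) x <= 8^-1 * excess s x.
Proof.
move=> Xs Xx; rewrite -lee_fin -(prox_stepE clX HA)//; last exact: bounded_borel_excess.
apply: le_trans (mean_excess Xs Xx Xx) _; rewrite lee_fin ler_wpM2l//.
have := excess_ge X0 cvX cptX lambda dF Xs Xx.
by rewrite /breg_e; lra.
Qed.

(** ApproxProx divides the mean excess by 8, because its error bound is at most an
    eighth of the excess of its starting point. *)
Lemma iter_step_excess s x i : X s -> X x ->
  iter i (step s) (excess s) x <= 8^-1 ^+ i * excess s x.
Proof.
move=> Xs; elim: i x => [|i IH] x Xx /=; first by rewrite expr0 mul1r.
have ne := bounded_borel_excess s.
apply: (@le_trans _ _ (step s (fun y => 8^-1 ^+ i * excess s y) x)).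
  apply: (prox_step_le clX HA) => //; first exact: bounded_borel_iter_step.
  exact: bounded_borelZ.
rewrite prox_step_scale// exprSr -mulrA ler_wpM2l ?exprn_ge0//.
exact: prox_step_excess.
Qed.

Lemma bounded_borel_sqdist (z : vec) :
  bounded_borel (fun x : vec => enorm (x - z) ^+ 2).
Proof. exact/bounded_borel_continuous/continuous_subspaceT/continuous_sqr_enormB. Qed.

Lemma bounded_borel_dotvB (b z : vec) : bounded_borel (fun x : vec => dotv b (x - z)).
Proof. exact/bounded_borel_continuous/continuous_subspaceT/continuous_dotvB. Qed.

Lemma iter_step_sqdist s x i : X s -> X x ->
  iter i (step s) (fun y : vec => enorm (y - prx s) ^+ 2) x
  <= 2 / lambda * excess s x * 8^-1 ^+ i.
Proof.
move=> Xs Xx; have ne := bounded_borel_excess s.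
apply: (@le_trans _ _ (iter i (step s) (fun y => 2 / lambda * excess s y) x)).
  apply: iter_step_le => //; first exact: bounded_borel_sqdist.
    exact: bounded_borelZ.
  move=> y Xy; have := le_excess X0 cvX cptX lambda cvF dF Xs Xy.
  by rewrite [2 / lambda * _]mulrAC ler_pdivlMr//; lra.
rewrite iter_step_scale// -mulrA ler_wpM2l ?divr_ge0 ?(ltW lambda0)//.
by rewrite mulrC; exact: iter_step_excess.
Qed.

Context (OW : oracle R d unit) (OU : oracle R d (vec * vec)).
Local Notation expect := (expect OW OA OU).

Lemma prox_step_sum (I : finType) s K (g : I -> vec -> R) x :
  (forall j, bounded_borel (g j)) -> X s -> X x ->
  (\int[seed_law OA]_u (K + \sum_j g j (@answer _ _ _ OA (s, x, x) u))%:E =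
   (K + \sum_j step s (g j) x)%:E)%E.
Proof.
move=> ng Xs Xx; under eq_integral do rewrite EFinD -sumEFin.
rewrite integralD//; first last.
- apply: integrable_sum => // j _; exact: (bounded_borel_integrable clX HA).
- exact: integrable_const.
rewrite expectation_const integral_sum//; last first.
  by move=> j; exact: (bounded_borel_integrable clX HA).
rewrite EFinD -sumEFin; congr (_ + _)%E; apply: eq_bigr => j _.
exact: (prox_stepE clX HA).
Qed.

(** The terms of an additive functional of the chain may be read at different times
    i j. In the induction on the length, the terms read at time 0 become constants
    and the other ones move one step closer. *)
Lemma expect_approx_prox_seq (I : finType) s n x K (i : I -> nat)
    (g : I -> vec -> R) (f : calls -> seq vec -> \bar R) :
  X s -> X x -> (forall j, bounded_borel (g j)) -> (forall j, i j <= n)%N ->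
  (forall c xs, (f c xs <= (K + \sum_j g j xs`_(i j))%:E)%E) ->
  (expect (approx_prox_seq s x n) f <=
   (K + \sum_j iter (i j) (step s) (g j) x)%:E)%E.
Proof.
move=> Xs; elim: n x i g f => [|n IHn] x i g f Xx ng le_in fle /=.
  apply: le_trans (fle _ _) _; rewrite lee_fin lerD2l; apply: ler_sum => j _.
  by have := le_in j; rewrite leqn0 => /eqP ->.
(* the data of the chain started at the next iterate *)
pose i' j := (i j).-1.
pose g' j := if i j == 0%N then (fun=> g j x) else g j.
have ng' j : bounded_borel (g' j).
  by rewrite /g'; case: ifP => _ //; exact: bounded_borel_const.
have -> : (K + \sum_j iter (i j) (step s) (g j) x)%:E =
    (\int[seed_law OA]_u (K + \sum_j iter (i' j) (step s) (g' j)
       (@answer _ _ _ OA (s, x, x) u))%:E)%E.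
  rewrite (@prox_step_sum I s K (fun j => iter (i' j) (step s) (g' j)) x)//; last first.
    by move=> j; exact: bounded_borel_iter_step.
  congr (_ + _)%:E; apply: eq_bigr => j _; rewrite -iterS /i' /g'.
  by case: (i j) => [|m] //=; rewrite prox_step_const.
apply: le_integral_nonmeasurable => u; rewrite expect_bind.
apply: IHn => //; first exact: (approx_in HA).
  by move=> j; rewrite /i'; case: (i j) (le_in j).
move=> c xs /=; apply: le_trans (fle _ _) _; rewrite lee_fin lerD2l.
by apply: ler_sum => j _; rewrite /i' /g'; case: (i j).
Qed.

Lemma proper_draws_approx_prox_seq s x n : proper_draws (@approx_prox_seq R d s x n).
Proof. by elim: n x => [//|n IH] x /= x'; apply: proper_draws_bind. Qed.

(** The contract of UnbiasedProx in the form used by the loop. Unbiasedness and the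
    variance bound together bound the mean of any quadratic function of the answer;
    asking only that G be below such a function covers continuations G of the
    program that are not known to be measurable. Boundedness of G is there for
    the geometric draw of MLMC. *)
Definition unbiased_impl (m : vec -> vec -> prog R d vec) :=
  forall s xp, X s -> X xp ->
  forall (G : calls -> vec -> \bar R) (K c M : R) b, 0 <= c ->
  (forall e y, `|G e y| <= M%:E)%E ->
  (forall e y, (G e y <= (K + dotv b (y - prx s) + c * enorm (y - prx s) ^+ 2)%:E)%E) ->
  (expect (m s xp) G <=
    (K + c / (4 * lambda) * (lambda * breg_e (prx s) s + breg X F (prx s) xp))%:E)%E.

(** Integrability of the coordinates comes from that of the squared distance, by
    |t| <= 1 + t^2. *)
Lemma unbiased_impl_call : is_UnbiasedProx X F lambda OU ->
  unbiased_impl (@call_unbiased R d).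
Proof.
move=> HU s xp Xs Xxp G K c M b c0 _ Gle /=.
have [_ meanU varU] := HU.
have manswer := unbiased_section_measurable clX HU Xs Xxp.
set z := prx s in Gle *; pose y u := @answer _ _ _ OU (s, xp) u.
have mN : measurable_fun setT (fun u => enorm (y u - z) ^+ 2).
  have cN := continuous_borel_measurable (@continuous_sqr_enormB R d z).
  exact: measurableT_comp cN manswer.
have iN : (seed_law OU).-integrable setT (EFin \o (fun u => enorm (y u - z) ^+ 2)).
  apply/integrableP; split; first exact/measurable_EFinP.
  under eq_integral do rewrite /= ger0_norm ?sqr_ge0//.
  by apply: le_lt_trans (varU _ _ Xs Xxp) _; rewrite ltry.
have icoord i : (seed_law OU).-integrable setT (EFin \o (fun u => y u 0 i)).
  have := integrable_affine (`|z 0 i| + 1) 1 iN; apply: le_integrable => //.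
    apply/measurable_EFinP.
    apply: (measurableT_comp
      (continuous_borel_measurable (g := fun w : vec => w 0 i) _) manswer).
    exact: coord_continuous.
  move=> u _ /=; rewrite lee_fin mul1r.
  rewrite [leRHS]ger0_norm ?addr_ge0 ?sqr_ge0//.
  have -> : y u 0 i = z 0 i + (y u - z) 0 i by rewrite !mxE; ring.
  apply: le_trans (ler_normD _ _) _.
  rewrite -addrA lerD2l sqr_enorm /dotv (bigD1 i)//=.
  have : 0 <= \sum_(j < d | j != i) (y u - z) 0 j * (y u - z) 0 j.
    by apply: sumr_ge0 => j _; rewrite -expr2 sqr_ge0.
  set t := (y u - z) 0 i; have := sqr_ge0 (`|t| - 1);
  have := real_normK (num_real t).
  nra.
pose h i u := - (b 0 i * z 0 i) + b 0 i * y u 0 i.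
have ih i : (seed_law OU).-integrable setT (EFin \o h i) by exact: integrable_affine.
have dotE u : (dotv b (y u - z))%:E = (\sum_i (h i u)%:E)%E.
  by rewrite sumEFin; congr EFin; apply: eq_bigr => i _; rewrite !mxE /h; ring.
have il : (seed_law OU).-integrable setT (EFin \o (fun u => dotv b (y u - z))).
  rewrite [X in integrable _ _ X](_ : _ = fun u => (\sum_i (h i u)%:E)%E).
    by apply: integrable_sum => // i _; exact: ih.
  by apply/funext => u; exact: dotE.
have mean0 : (\int[seed_law OU]_u (dotv b (y u - z))%:E = 0)%E.
  under eq_integral do rewrite dotE.
  rewrite integral_sum//; apply: big1 => i _.
  rewrite expectation_affine// meanU// -EFinM -EFinD; congr EFin.
  by rewrite addrC subrr.
apply: (@le_trans _ _ (\int[seed_law OU]_u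
   ((dotv b (y u - z))%:E + (K + c * enorm (y u - z) ^+ 2)%:E))%E).
  by apply: le_integral_nonmeasurable => u; rewrite -EFinD addrCA addrA; exact: Gle.
rewrite integralD//; last exact: integrable_affine.
rewrite mean0 add0e expectation_affine//.
apply: le_trans (leeD2l _ (lee_wpmul2l _ (varU _ _ Xs Xxp))) _.
  by rewrite lee_fin.
by rewrite -EFinM -EFinD lee_fin mulrA.
Qed.

(** The bias of the i-th iterate vanishes: 2 <b, u> <= h |b|^2 + |u|^2 / h with
    h = 2^-i, which tends to 0 so slowly that the second moment, of order 8^-i, is
    still small after division by h. *)
Lemma iter_step_dotv_le s b x i : X s -> X x ->
  iter i (step s) (fun y : vec => dotv b (y - prx s)) x
  <= (enorm b ^+ 2 + 2 / lambda * excess s x) / 2 * 2^-1 ^+ i.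
Proof.
move=> Xs Xx; set z := prx s.
have h0 : 0 < (2^-1 : R) ^+ i by rewrite exprn_gt0.
have h1 : (2^-1 : R) ^+ i <= 1 by rewrite exprn_ile1// invf_le1// ler1n.
have q0 : 0 <= 2 / lambda * excess s x.
  rewrite mulr_ge0 ?divr_ge0 ?(ltW lambda0)//.
  apply: le_trans (le_excess X0 cvX cptX lambda cvF dF Xs Xx).
  by rewrite mulr_ge0 ?sqr_ge0 ?divr_ge0 ?(ltW lambda0).
apply: (@le_trans _ _ (iter i (step s)
    (fun y : vec => 1 * (2^-1 ^+ i / 2 * enorm b ^+ 2)
      + (2 * 2^-1 ^+ i)^-1 * enorm (y - z) ^+ 2) x)).
  apply: iter_step_le => //; first exact: bounded_borel_dotvB.
    apply: bounded_borelD; first exact: bounded_borel_const.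
    by apply: bounded_borelZ; exact: bounded_borel_sqdist.
  move=> y Xy; have := sqr_ge0 (enorm (2^-1 ^+ i *: b - (y - z))).
  rewrite (sqr_enormD (2^-1 ^+ i *: b)) sqr_enormZ sqr_enormN dotvNr dotvZl => H.
  rewrite -(ler_pM2l h0) -(ler_pM2l (ltr0n R 2)).
  rewrite mul1r !mulrDr.
  have -> (u : R) : 2 * (2^-1 ^+ i * ((2 * 2^-1 ^+ i)^-1 * u)) = u.
    by field; rewrite expf_neq0.
  lra.
rewrite (@iter_step_comb s 1 _ (fun=> 2^-1 ^+ i / 2 * enorm b ^+ 2))//;
  last exact: bounded_borel_sqdist.
  have := iter_step_sqdist i Xs Xx; rewrite iter_step_const eighth_pow -/z.
  set N := iter _ _ _ _; set q := 2 / lambda * _ in q0 *; set h := 2^-1 ^+ i in h0 h1 *.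
  move=> HN; rewrite mul1r.
  have : (2 * h)^-1 * N <= h ^+ 2 * q / 2.
    rewrite ler_pdivrMl ?mulr_gt0//; apply: le_trans HN _.
    by rewrite le_eqVlt; apply/orP; left; apply/eqP; field.
  have : h ^+ 2 * q <= h * q by rewrite ler_wpM2r// expr2 ler_piMl// ltW.
  lra.
exact: bounded_borel_const.
Qed.

Lemma iter_step_dotv s b x i : X s -> X x ->
  `|iter i (step s) (fun y : vec => dotv b (y - prx s)) x|
  <= (enorm b ^+ 2 + 2 / lambda * excess s x) / 2 * 2^-1 ^+ i.
Proof.
move=> Xs Xx; rewrite ler_norml iter_step_dotv_le// andbT lerNl.
have := iter_step_dotv_le (- b) i Xs Xx; rewrite sqr_enormN.
rewrite (_ : (fun y : vec => dotv (- b) _) = (fun y : vec => - 1 * dotv b (y - prx s))).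
  by rewrite iter_step_scale ?mulN1r//; exact: bounded_borel_dotvB.
by apply/funext => y; rewrite dotvNl mulN1r.
Qed.

(** All levels are summed with the first iterate x^(0) fixed; its randomness is
    averaged last, when only its excess is left. That gives a variance of at most
    (42/64) (2/lambda) (1/8) times the error scale, below the allowed 1/(4 lambda). *)
Lemma unbiased_impl_mlmc : unbiased_impl (mlmc 2^-1 2).
Proof.
have p01 : 0 <= (2^-1 : R) < 1 by rewrite invr_ge0 ler0n invf_lt1 ?ltr1n.
pose level (s x : vec) (k : nat) : prog R d vec :=
  bind (@approx_prox_seq R d s x (2 + k)) (fun xs => Ret (xs`_2 +
    ((1 - 2^-1) * 2^-1 ^+ k)^-1 *: (xs`_(2 + k) - xs`_(maxn k.+1 2)) : vec)).
have proper s x k : proper_draws (level s x k).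
  by apply: proper_draws_bind => //; exact: proper_draws_approx_prox_seq.
move=> s xp Xs Xxp G K c M b c0 GM Gle; set z := prx s in Gle *.
pose q x := 2 / lambda * excess s x.
have level_sum (x : vec) (G' : calls -> vec -> \bar R) : X x ->
  (forall e y, `|G' e y| <= M%:E)%E ->
  (forall e y, (G' e y <= (K + dotv b (y - z) + c * enorm (y - z) ^+ 2)%:E)%E) ->
  (expect (Geometric 2^-1 (level s x)) G'
   <= (K + c * q x * (42 / 64))%:E)%E.
  move=> Xx G'M G'le.
  have eM k := expect_bounded (OW := OW) (OA := OA) (OU := OU) (proper s x k)
    (surelyT _ _ _ _ G'M).
  have [r [l [er rl]]] := geometric_mean p01 eM.
  rewrite /= => ->; rewrite lee_fin.
  pose l_ (y : vec) := dotv b (y - z); pose N_ (y : vec) := enorm (y - z) ^+ 2.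
  have nl : bounded_borel l_ by exact: bounded_borel_dotvB.
  have nN : bounded_borel N_ by exact: bounded_borel_sqdist.
  apply: (mlmc_series_le (L := fun i => iter i (step s) l_ x) _ _ _ rl).
  - rewrite mulr_ge0// mulr_ge0 ?divr_ge0 ?(ltW lambda0)//.
    apply: le_trans (le_excess X0 cvX cptX lambda cvF dF Xs Xx).
    by rewrite mulr_ge0 ?sqr_ge0 ?divr_ge0 ?(ltW lambda0).
  - by move=> i; exact: iter_step_dotv.
  move=> k; rewrite -lee_fin -er expect_bind.
  set w := (1 - 2^-1) * 2^-1 ^+ k; set v := w^-1.
  (* |a + v (p - q)|^2 <= 2 |a|^2 + 4 v^2 (|p|^2 + |q|^2) splits the quadratic
     function of the estimator into terms that each involve one iterate *)
  pose ind (j : 'I_3) := nth 0%N [:: 2; 2 + k; maxn k.+1 2]%N j.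
  pose g (j : 'I_3) := nth (fun=> 0)
    [:: fun y => 1 * l_ y + (2 * c) * N_ y;
        fun y => v * l_ y + (4 * c * v ^+ 2) * N_ y;
        fun y => - v * l_ y + (4 * c * v ^+ 2) * N_ y] j.
  have ng j : bounded_borel (g j).
    case: j => -[|[|[|m]]] jlt; rewrite /g/= ?nth_nil;
      by [exact: bounded_borel_const
         |exact: (bounded_borelD (bounded_borelZ _ nl) (bounded_borelZ _ nN))].
  apply: le_trans (@expect_approx_prox_seq _ s (2 + k) x K ind g _ Xs Xx ng _ _) _.
  - by case=> -[|[|[|m]]] jlt; rewrite /ind/= ?nth_nil ?geq_max ?add2n ?leqnSn.
  - move=> e xs; apply: le_trans (G'le _ _) _; rewrite lee_fin.
    rewrite !big_ord_recl big_ord0 /g /ind /= /l_ /N_.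
    set x2 := xs`_2; set xJ := xs`_(2 + k); set xJ' := xs`_(maxn k.+1 2).
    have -> : x2 + v *: (xJ - xJ') - z = (x2 - z) + v *: ((xJ - z) - (xJ' - z)).
      by rewrite opprB addrA subrK addrAC.
    have := sqr_enormD_le (x2 - z) (v *: ((xJ - z) - (xJ' - z))).
    have := sqr_enormD_le (xJ - z) (- (xJ' - z)).
    rewrite sqr_enormZ sqr_enormN !dotvDr dotvZr dotvDr dotvNr.
    move=> /(ler_wpM2l (sqr_ge0 v)) H1 H2.
    have := ler_wpM2l c0 H2; have := ler_wpM2l c0 H1.
    rewrite !(dotvDr, dotvNr); lra.
  pose L i := iter i (step s) l_ x; pose N i := iter i (step s) N_ x.
  have comb i a a' :
      iter i (step s) (fun y => a * l_ y + a' * N_ y) x = a * L i + a' * N i.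
    by rewrite iter_step_comb.
  have -> : \sum_j iter (ind j) (step s) (g j) x =
      (1 * L 2%N + (2 * c) * N 2%N)
      + ((v * L (2 + k)%N + (4 * c * v ^+ 2) * N (2 + k)%N)
      + ((- v * L (maxn k.+1 2) + (4 * c * v ^+ 2) * N (maxn k.+1 2)) + 0)).
    rewrite !big_ord_recl big_ord0; congr (_ + (_ + (_ + _))); exact: comb.
  rewrite -exprVn -/v lee_fin -/(L 2%N) -/(L (2 + k)%N) -/(L (maxn k.+1 2)).
  have NE i : N i <= q x * 8^-1 ^+ i by exact: iter_step_sqdist.
  have cv0 : 0 <= 4 * c * v ^+ 2 by rewrite mulr_ge0 ?sqr_ge0 ?mulr_ge0.
  clearbody L N.
  have := ler_wpM2l c0 (NE 2%N); have := ler_wpM2l cv0 (NE (2 + k)%N).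
  have := ler_wpM2l cv0 (NE (maxn k.+1 2)); lra.
rewrite [expect _ _]/=.
apply: (@le_trans _ _ (\int[seed_law OA]_u
   (K + c * (2 / lambda) * (42 / 64) * excess s (@answer _ _ _ OA (s, s, xp) u))%:E)%E).
  apply: le_integral_nonmeasurable => u; have Xu := approx_in HA u Xs Xs Xxp.
  apply: le_trans (@level_sum _ _ Xu _ _) _.
  - by move=> e y; exact: GM.
  - by move=> e y; exact: Gle.
  - by rewrite lee_fin /q lerD2l le_eqVlt; apply/orP; left; apply/eqP; ring.
rewrite expectation_affine; last first.
  exact: (bounded_borel_integrable clX HA (bounded_borel_excess s) Xs Xs Xxp).
have Xz : X z by exact: prox_in.
have B0 : 0 <= lambda * breg_e z s + breg X F z xp.
  by rewrite addr_ge0 ?breg_ge0// mulr_ge0 ?(ltW lambda0)// mulr_ge0 ?invr_ge0 ?sqr_ge0.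
have a0 : 0 <= c * (2 / lambda) * (42 / 64).
  by rewrite !mulr_ge0// invr_ge0 ltW.
apply: le_trans (leeD2l _ (lee_wpmul2l _ (mean_excess Xs Xs Xxp))) _.
  by rewrite lee_fin.
rewrite -EFinM -EFinD lee_fin lerD2l -/z.
set B := (lambda * _ + _) in B0 *.
rewrite mulrA ler_wpM2r//.
have -> : c / (4 * lambda) = c * (2 / lambda) * (1 / 8) by field; rewrite gt_eqF.
have : 0 <= c * (2 / lambda) by rewrite !mulr_ge0// invr_ge0 ltW.
by set t := c * _; lra.
Qed.

End mlmc_moments.

(** * Counting calls *)

Section counting.
Context (R : realType) (d : nat).
Local Notation vec := 'rV[R]_d.
Context (OW : oracle R d unit) (OA : oracle R d (vec * vec * vec))
  (OU : oracle R d (vec * vec)).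
Local Notation expect := (expect OW OA OU).

Lemma expect_geometric (A : Type) (p : R) (k : nat -> prog R d A) f :
  expect (Geometric p k) f =
  (\sum_(0 <= n <oo) (((1 - p) * p ^+ n)%:E * expect (k n) f))%E.
Proof. by []. Qed.

Lemma expect_ge0 (A : Type) (m : prog R d A) (f : calls -> A -> \bar R) :
  proper_draws m -> (forall c a, (0 <= f c a)%E) -> (0 <= expect m f)%E.
Proof.
elim: m f => [a|k IH|s xi xp k IH|s xp k IH|p k IH] f /=.
- by move=> _ f0.
- by move=> Hk f0; apply: integral_ge0 => u _; apply: IH => // c a; exact: f0.
- by move=> Hk f0; apply: integral_ge0 => u _; apply: IH => // c a; exact: f0.
- by move=> Hk f0; apply: integral_ge0 => u _; apply: IH => // c a; exact: f0.
- move=> [p01 Hk] f0; apply: nneseries_ge0 => n _ _.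
  by rewrite mule_ge0 ?IH// lee_fin geometric_weight_ge0.
Qed.

Lemma ge0_expect_le (A : Type) (m : prog R d A) (f g : calls -> A -> \bar R) :
  proper_draws m -> (forall c a, (0 <= f c a)%E) -> (forall c a, (f c a <= g c a)%E) ->
  (expect m f <= expect m g)%E.
Proof.
elim: m f g => [a|k IH|s xi xp k IH|s xp k IH|p k IH] f g /=.
- by move=> _ _ fg.
- move=> Hk f0 fg; apply: le_integral_nonmeasurable => u.
  by apply: IH => // c a; [exact: f0|exact: fg].
- move=> Hk f0 fg; apply: le_integral_nonmeasurable => u.
  by apply: IH => // c a; [exact: f0|exact: fg].
- move=> Hk f0 fg; apply: le_integral_nonmeasurable => u.
  by apply: IH => // c a; [exact: f0|exact: fg].
- move=> [p01 Hk] f0 fg; have w0 n := geometric_weight_ge0 p01 n.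
  apply: lee_nneseries => n _; first by rewrite mule_ge0 ?expect_ge0// lee_fin.
  by rewrite lee_wpmul2l ?lee_fin// IH.
Qed.

(** The number of ApproxProx calls with an offset r that stands for the calls already
    made, so that inductions on programs go through. *)
Definition approx_count (r : R) (A : Type) (c : calls) (_ : A) : \bar R :=
  ((n_approx c)%:R + r)%:E.

Lemma approx_count_add r A n m l :
  (fun c => @approx_count r A c) \o add_calls (Calls n m l) =
  approx_count (m%:R + r) (A := A).
Proof.
apply/funext => c; apply/funext => a.
by rewrite /= /approx_count /= natrD addrA [_ + m%:R]addrC.
Qed.

Lemma expect_approx_prox_seq_count s x n (r : R) :
  expect (approx_prox_seq s x n) (approx_count r (A := _)) = (n%:R + r)%:E.
Proof.
elim: n x r => [//|n IH] x r /=.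
have E y : expect (bind (approx_prox_seq s y n) (fun xs => Ret (x :: xs)))
    (approx_count r (A := _) \o add_calls (Calls 0 1 0)) = (n%:R + (1 + r))%:E.
  rewrite expect_bind approx_count_add -(IH y); congr expect.
  by apply/funext => c; apply/funext => xs; rewrite /= /approx_count /= addn0.
under eq_integral do rewrite E.
by rewrite expectation_const -natr1 addrA.
Qed.

(** The partial sums of the mean of 2 + k + r stay below its full value 3 + r, the
    missing part being 2^-N (3 + r + N). *)
Lemma expect_geometric_count s x (g : nat -> seq vec -> vec) (r : R) : 0 <= r ->
  (expect (Geometric 2^-1 (fun k => bind (approx_prox_seq s x (2 + k))
     (fun xs => Ret (g k xs)))) (approx_count r (A := _)) <= (3 + r)%:E)%E.
Proof.
move=> r0.
have p01 : 0 <= (2^-1 : R) < 1 by rewrite invr_ge0 ler0n invf_lt1 ?ltr1n.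
rewrite expect_geometric; under eq_eseriesr => k _.
  rewrite expect_bind (_ : (fun c xs => _) = approx_count r (A := _)); last first.
    by apply/funext => c; apply/funext => xs; rewrite /= /approx_count /= addn0.
  rewrite expect_approx_prox_seq_count -EFinM.
  over.
apply: lime_le.
  apply: is_cvg_nneseries => k _ _; rewrite lee_fin mulr_ge0 ?geometric_weight_ge0//.
  by rewrite addr_ge0 ?ler0n.
apply: nearW => N; rewrite sumEFin lee_fin.
have -> : \sum_(0 <= k < N) (1 - 2^-1) * 2^-1 ^+ k * ((2 + k)%:R + r) =
    (3 + r) - 2^-1 ^+ N * (3 + r + N%:R).
  elim: N => [|N IHN]; first by rewrite big_nil expr0; ring.
  by rewrite big_nat_recr//= IHN exprS -natr1 natrD; set h := _ ^+ N; field.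
have : 0 <= (2^-1 : R) ^+ N * (3 + r + N%:R).
  by rewrite mulr_ge0 ?exprn_ge0// !addr_ge0 ?ler0n.
lra.
Qed.

Lemma expect_mlmc_count s xp (r : R) : 0 <= r ->
  (expect (mlmc 2^-1 2 s xp) (approx_count r (A := _)) <= (4 + r)%:E)%E.
Proof.
move=> r0; apply: expectation_le => u; rewrite approx_count_add.
by apply: le_trans (expect_geometric_count _ _ _ _) _; rewrite ?addr_ge0// lee_fin; lra.
Qed.

Lemma proper_draws_mlmc s xp : proper_draws (@mlmc R d 2^-1 2 s xp).
Proof.
move=> x0; split; first by rewrite invr_ge0 ler0n invf_lt1 ?ltr1n.
by move=> k; apply: (@proper_draws_bind _ _ _ _ (approx_prox_seq s x0 (2 + k))) => //;
  exact: proper_draws_approx_prox_seq.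
Qed.

Lemma proper_draws_recapp_loop X alpha unbiased n t x v :
  (forall s xp, proper_draws (unbiased s xp)) ->
  proper_draws (@recapp_loop R d X alpha unbiased n t x v).
Proof.
move=> H; elim: n t x v => [//|n IH] t x v /= x'.
by apply: proper_draws_bind.
Qed.

Lemma expect_recapp_loop_count X alpha unbiased (q : R) n t x v (r : R) :
  0 <= q -> (forall s xp, proper_draws (unbiased s xp)) ->
  (forall s xp (r : R), 0 <= r ->
    (expect (unbiased s xp) (approx_count r (A := _)) <= (q + r)%:E)%E) ->
  0 <= r ->
  (expect (recapp_loop X alpha unbiased n t x v) (approx_count r (A := _))
   <= ((1 + q) * n%:R + r)%:E)%E.
Proof.
move=> q0 proper countU; elim: n t x v r => [|n IH] t x v r r0 /=.
  by rewrite /approx_count lee_fin mulr0.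
apply: expectation_le => u; rewrite expect_bind approx_count_add.
set s := _ + _; set x' := answer _ _.
have qn0 : 0 <= (1 + q) * n%:R by rewrite mulr_ge0 ?addr_ge0.
apply: (@le_trans _ _ (expect (unbiased s x)
  (approx_count ((1 + q) * n%:R + (1 + r)) (A := _)))).
  apply: ge0_expect_le => //.
    move=> c y; apply: expect_ge0; first exact: proper_draws_recapp_loop.
    by move=> e z; rewrite lee_fin !addr_ge0.
  move=> c y; case: c => cw ca cu; rewrite approx_count_add.
  apply: le_trans (IH _ _ _ _ _) _; first by rewrite !addr_ge0.
  by rewrite /approx_count/= lee_fin; lra.
apply: le_trans (countU _ _ _ _) _; first by rewrite !addr_ge0.
by rewrite lee_fin -natr1; lra.
Qed.

End counting.

(** * The weights *)

Section weights.
Context (R : realType) (alpha : nat -> R).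
Hypothesis Halpha : recapp_weights alpha.

(** A vanishing weight would, with 0^-1 = 0, force the previous weight to vanish, and
    alpha 0 = 1. *)
Lemma recapp_weights_gt0 t : 0 < alpha t.
Proof.
case: Halpha => a0 aS; elim: t => [|t IH]; first by rewrite a0.
have [/andP[h0 _] h] := aS t; rewrite lt_neqAle h0 andbT eq_sym.
apply/eqP => at0; move: h; rewrite at0 expr0n/= invr0 subrr => /esym/eqP.
by rewrite invr_eq0 expf_eq0/= gt_eqF.
Qed.

Lemma recapp_weights_inv t :
  (alpha t.+1)^-1 ^+ 2 - (alpha t.+1)^-1 = (alpha t)^-1 ^+ 2.
Proof. by case: Halpha => _ /(_ t)[_]; rewrite !exprVn. Qed.

(** For b = 1/alpha the recursion reads (b' - 1/2)^2 = b^2 + 1/4, so b' >= b + 1/2. *)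
Lemma recapp_weights_growth t : 1 + t%:R / 2 <= (alpha t)^-1.
Proof.
elim: t => [|t IH]; first by case: Halpha => -> _; rewrite invr1 mul0r addr0.
have b0 : 0 < (alpha t.+1)^-1 by rewrite invr_gt0 recapp_weights_gt0.
have := recapp_weights_inv t; move: IH b0.
have := ler0n R t; rewrite -[t.+1%:R]natr1.
set b := (alpha t)^-1; set b' := (alpha t.+1)^-1 => t0 IH b0 h.
rewrite leNgt; apply/negP => hb.
have : b' < b + 1 / 2 by lra.
nra.
Qed.

(** From 1/alpha_t >= 1 the recursion gives b' (b' - 1) >= 1 for b' = 1/alpha_(t+1),
    whereas (8/5) (3/5) = 24/25 < 1. *)
Lemma recapp_weights_le t : alpha t.+1 <= 5 / 8.
Proof.
have a0 := recapp_weights_gt0 t.+1.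
have := recapp_weights_inv t; have := recapp_weights_growth t.
have b0 : 0 < (alpha t.+1)^-1 by rewrite invr_gt0.
have := ler0n R t => t0 H1 H2.
have b1 : 1 <= (alpha t)^-1 by lra.
have H3 : 8 / 5 <= (alpha t.+1)^-1.
  by move: b1 b0 H2; set b := (alpha t)^-1; set b' := (alpha t.+1)^-1 => *; nra.
by rewrite -[alpha _]invrK invf_ple ?posrE//; lra.
Qed.

End weights.

(** * Decrease of the potential *)

Section recapp_potential.
Context (R : realType) (d : nat) (X : set 'rV[R]_d) (F : 'rV[R]_d -> R) (lambda : R).
Local Notation vec := 'rV[R]_d.
Hypothesis X0 : X !=set0.
Hypothesis clX : closed X.
Hypothesis cvX : convex_set (X : set (convex_lmodType 'rV[R]_d)).
Hypothesis cptX : compact X.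
Hypothesis cvF : convex_function (X : set (convex_lmodType 'rV[R]_d)) F.
Hypothesis dF : differentiable_on X F.
Hypothesis lambda0 : 0 < lambda.
Context (OW : oracle R d unit) (OA : oracle R d (vec * vec * vec))
  (OU : oracle R d (vec * vec)).
Hypothesis HA : is_ApproxProx X F lambda OA.
Local Notation expect := (expect OW OA OU).
Local Notation surely := (surely OW OA OU).
Local Notation prx s := (prox X F lambda s).
Local Notation excess := (prox_excess X F lambda).
Context (alpha : nat -> R).
Hypothesis Halpha : recapp_weights alpha.
Context (unbiased : vec -> vec -> prog R d vec).

Lemma recapp_query_in t x v : X x -> X v ->
  X ((1 - alpha t.+1) *: x + alpha t.+1 *: v).
Proof.
move=> Xx Xv; apply: convex_set_comb => //.
by rewrite ltW ?recapp_weights_gt0//= (le_trans (recapp_weights_le Halpha t))//; lra.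
Qed.

Lemma surely_recapp_loop n t x v : X x -> X v ->
  surely (recapp_loop X alpha unbiased n t x v) (fun _ y => X y).
Proof.
elim: n t x v => [//|n IH] t x v Xx Xv /= u.
have Xs := recapp_query_in t Xx Xv.
rewrite surely_bind; apply: surelyT => c y; apply: IH.
  exact: (approx_in HA).
exact: (projP X0 cvX cptX _).1.
Qed.

(** The three-point inequality at x, with weight alpha_t^-2 = a^-2 - a^-1, plus the one
    at y, with weight a^-1. The weights sum to a^-2, and
    (a^-2 - a^-1) (x - z) + a^-1 (y - z) = a^-2 (s - z) + a^-1 (y - v)
    because s = (1 - a) x + a v. *)
Lemma recapp_step_le t x v y : X x -> X v -> X y ->
  let a := alpha t.+1 in
  let s := (1 - a) *: x + a *: v in
  a ^- 2 * (F (prx s) - F y) <=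
  alpha t ^- 2 * (F x - F y - breg X F (prx s) x)
  - lambda * a ^- 2 * enorm (prx s - s) ^+ 2
  - lambda * a^-1 * dotv (v - y) (prx s - s).
Proof.
move=> Xx Xv Xy; cbv zeta; set a := alpha t.+1; set s := _ + a *: v.
have Xs : X s by exact: recapp_query_in.
have a0 : 0 < a by exact: recapp_weights_gt0.
have b0 : 0 < a^-1 by rewrite invr_gt0.
have HA2 := recapp_weights_inv Halpha t; rewrite -!exprVn -/a in HA2 *.
have Hx := prox_three_point X0 cvX cptX lambda dF Xs Xx.
have Hy := prox_three_point X0 cvX cptX lambda dF Xs Xy.
have := breg_ge0 cvX cvF dF (prox_in X0 cptX lambda dF s) Xy.
move: Hx Hy; set z := prx s; set Vx := breg _ _ _ x; set Vy := breg _ _ _ y.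
have [w wE] : exists w, w = z - s by exists (z - s).
rewrite -wE -HA2 (dotvC (v - y)) !dotvDr !dotvNr.
have -> : enorm w ^+ 2 = dotv w z - dotv w s.
  by rewrite sqr_enorm {2}wE dotvDr dotvNr.
have bs : lambda * a^-1 ^+ 2 * dotv w s = lambda *
    ((a^-1 ^+ 2 - a^-1) * dotv w x + a^-1 * dotv w v).
  by rewrite /s !dotvE; field; rewrite gt_eqF.
move=> Hx Hy Vy0.
have t0 : 0 <= a^-1 ^+ 2 - a^-1 by rewrite HA2 sqr_ge0.
have := ler_wpM2l t0 Hx; have := ler_wpM2l (ltW b0) Hy.
have := mulr_ge0 (ltW b0) Vy0; lra.
Qed.

Hypothesis proper_unbiased : forall s xp, proper_draws (unbiased s xp).
Hypothesis HU : unbiased_impl X F lambda OA OW OU unbiased.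

(** The mean output gap of the remaining n iterations is at most the final weight
    squared times the current potential. In the step, the terms linear in the answer
    of UnbiasedProx are averaged to those of the exact proximal point and cancel the
    scalar product in [recapp_step_le]. In units of g a^-2, with W = lambda |z - s|^2
    and V = V_z(x), what remains is W (1/2 + 3/16 + 1/4 - 1) + V (3/8 - (1 - a)),
    which is nonpositive as a <= 5/8. *)
Lemma expect_recapp_loop_le n t x v y : X x -> X v -> X y ->
  (expect (recapp_loop X alpha unbiased n t x v) (fun _ x' => (F x')%:E) <=
   (F y + alpha (t + n)%N ^+ 2 * (alpha t ^- 2 * (F x - F y)
      + lambda / 2 * enorm (v - y) ^+ 2))%:E)%E.
Proof.
move=> + + Xy; elim: n t x v => [|n IH] t x v Xx Xv.
  have a0 := recapp_weights_gt0 Halpha t.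
  rewrite /= lee_fin addn0.
  have -> p : alpha t ^+ 2 * (alpha t ^- 2 * (F x - F y) + p) =
      F x - F y + alpha t ^+ 2 * p by field; rewrite gt_eqF.
  have : 0 <= alpha t ^+ 2 * (lambda / 2 * enorm (v - y) ^+ 2).
    by rewrite mulr_ge0 ?sqr_ge0// mulr_ge0 ?sqr_ge0// divr_ge0// ltW.
  lra.
have step := recapp_step_le t Xx Xv Xy; cbv zeta in step.
have Xs := recapp_query_in t Xx Xv.
rewrite [recapp_loop _ _ _ _ _ _ _]/=.
move: step Xs; set a := alpha t.+1; set s := _ + a *: v; set z := prx s => step Xs.
have Xz : X z by exact: prox_in.
have a0 : 0 < a by exact: recapp_weights_gt0.
have a58 : a <= 5 / 8 by exact: recapp_weights_le.
set g := alpha (t + n.+1)%N ^+ 2; have g0 : 0 <= g by exact: sqr_ge0.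
set B := lambda * breg_e z s + breg X F z x.
pose V := breg X F z x; have V0 : 0 <= V by exact: breg_ge0.
have [M FM] := within_continuous_bounded X0 cptX (differentiable_within_continuous dF).
(* the part of the bound that depends on neither answer *)
pose Kc := F y + g * (lambda / 2 * (enorm (v - y) ^+ 2
   + 2 / a * dotv (v - y) (z - s) + a ^- 2 * enorm (z - s) ^+ 2)).
have inner x' : X x' ->
  (expect (bind (unbiased s x) (fun xt => recapp_loop X alpha unbiased n t.+1 x'
       (Defs.proj X (v - a^-1 *: (s - xt))))) (fun _ x' => (F x')%:E)
   <= (Kc + g * a ^- 2 * (F x' - F y) + g * a ^- 2 / 8 * B)%:E)%E.
  move=> Xx'; rewrite expect_bind.
  have := @HU _ _ Xs Xx _ (Kc + g * a ^- 2 * (F x' - F y)) (g * lambda / 2 * a ^- 2) M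
    ((g * lambda) *: (a^-1 *: (v - y) + a ^- 2 *: (z - s))).
  rewrite (_ : g * lambda / 2 * a ^- 2 / (4 * lambda) = g * a ^- 2 / 8); last first.
    by field; rewrite !gt_eqF.
  apply.
  - by rewrite mulr_ge0 ?invr_ge0 ?sqr_ge0// divr_ge0// mulr_ge0// ltW.
  - move=> e xt; apply: expect_bounded.
      exact: proper_draws_recapp_loop.
    apply: surely_sub (surely_recapp_loop _ _ _ _); last 2 first.
    + exact: Xx'.
    + exact: (projP X0 cvX cptX _).1.
    by move=> c x''; rewrite /= lee_fin; exact: FM.
  move=> e xt.
  have [Xp Hp] := projP X0 cvX cptX (v - a^-1 *: (s - xt)).
  apply: le_trans (IH _ _ _ Xx' Xp) _; rewrite lee_fin addSnnS -/g -/a.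
  have := Hp _ Xy.
  have -> : v - a^-1 *: (s - xt) - y = (v - y) + a^-1 *: ((xt - z) + (z - s)).
    by rewrite addrA subrK -(opprB xt s) scalerN opprK addrAC.
  have -> : enorm ((v - y) + a^-1 *: ((xt - z) + (z - s))) ^+ 2 =
      enorm (v - y) ^+ 2 + 2 / a * (dotv (v - y) (xt - z) + dotv (v - y) (z - s))
      + a ^- 2 * (enorm (xt - z) ^+ 2 + 2 * dotv (z - s) (xt - z) + enorm (z - s) ^+ 2).
    rewrite (sqr_enormD (v - y) (a^-1 *: _)) sqr_enormZ (sqr_enormD (xt - z)).
    by rewrite dotvZr (dotvDr (xt - z)) (dotvC (z - s)) exprVn; ring.
  rewrite dotvZl (dotvDl (a^-1 *: _)) !dotvZl.
  move=> /(ler_wpM2l (mulr_ge0 g0 (ltW lambda0))); rewrite /Kc; lra.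
apply: (@le_trans _ _ (\int[seed_law OA]_u
   (Kc + g * a ^- 2 / 8 * B + g * a ^- 2 * (regularized F lambda s z
      - lambda / 4 * enorm (z - s) ^+ 2 - F y)
    + g * a ^- 2 * 2 * excess s (@answer _ _ _ OA (s, s, x) u))%:E)%E).
  apply: le_integral_nonmeasurable => u; have Xu := approx_in HA u Xs Xs Xx.
  apply: le_trans (inner _ Xu) _; rewrite lee_fin.
  have := objective_le_excess X0 cvX cptX cvF dF lambda0 Xs Xu.
  have ga0 : 0 <= g * a ^- 2 by rewrite mulr_ge0 ?invr_ge0 ?sqr_ge0.
  by move=> /(ler_wpM2l ga0); rewrite -/z; lra.
rewrite expectation_affine; last first.
  have nexcess := bounded_borel_excess lambda X0 clX cptX dF s.
  exact: (bounded_borel_integrable clX HA nexcess Xs Xs Xx).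
have ga0 : 0 <= g * a ^- 2 * 2.
  by rewrite mulr_ge0// mulr_ge0 ?invr_ge0 ?sqr_ge0.
apply: le_trans (leeD2l _ (lee_wpmul2l _ (mean_excess X0 clX cptX dF HA Xs Xs Xx))) _.
  by rewrite lee_fin.
rewrite -EFinM -EFinD lee_fin -/z -/B /Kc /regularized.
have BE : B = lambda * (2^-1 * enorm (z - s) ^+ 2) + V.
  by rewrite /B /breg_e sqr_enorm_distC.
have VA : a ^- 2 * V * (3 / 8) <= alpha t ^- 2 * V.
  have HA2 := recapp_weights_inv Halpha t; rewrite !exprVn -/a in HA2.
  rewrite -HA2 (_ : a ^- 2 - a^-1 = a ^- 2 * (1 - a)); last by field; rewrite gt_eqF.
  have QV : 0 <= a ^- 2 * V by rewrite mulr_ge0 ?invr_ge0 ?sqr_ge0.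
  have := ler_wpM2l QV a58; lra.
have W0 : 0 <= lambda * a ^- 2 * enorm (z - s) ^+ 2.
  by rewrite mulr_ge0 ?sqr_ge0// mulr_ge0 ?invr_ge0 ?sqr_ge0// ltW.
move: step; rewrite BE -/V -/a -/s -/z => /(ler_wpM2l g0).
have := ler_wpM2l g0 VA; have := mulr_ge0 g0 W0; lra.
Qed.

End recapp_potential.

(** * Guarantees of the algorithm *)

Section recapp_guarantees.
Context (R : realType) (d : nat) (X : set 'rV[R]_d) (F : 'rV[R]_d -> R) (lambda D : R).
Local Notation vec := 'rV[R]_d.
Hypothesis X0 : X !=set0.
Hypothesis clX : closed X.
Hypothesis cvX : convex_set (X : set (convex_lmodType 'rV[R]_d)).
Hypothesis XD : forall x y, X x -> X y -> enorm (x - y) <= D.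
Hypothesis cvF : convex_function (X : set (convex_lmodType 'rV[R]_d)) F.
Hypothesis dF : differentiable_on X F.
Hypothesis lambda0 : 0 < lambda.
Context (OW : oracle R d unit) (OA : oracle R d (vec * vec * vec))
  (OU : oracle R d (vec * vec)).
Hypothesis HW : is_WarmStart X F lambda D OW.
Hypothesis HA : is_ApproxProx X F lambda OA.
Local Notation expect := (expect OW OA OU).
Local Notation surely := (surely OW OA OU).
Context (alpha : nat -> R).
Hypothesis Halpha : recapp_weights alpha.

Let cptX : compact X := bounded_diameter_compact X0 clX XD.

Lemma warm_start_in u : X (@answer _ _ _ OW tt u).
Proof. by case: HW. Qed.

Lemma warm_start_mean :
  (\int[seed_law OW]_u (F (@answer _ _ _ OW tt u))%:E
   <= (minval X F + lambda * D ^+ 2)%:E)%E.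
Proof. by case: HW => _ _; rewrite leeBlDr// -EFinD addrC. Qed.

Lemma warm_start_integrable :
  (seed_law OW).-integrable setT (EFin \o (fun u => F (@answer _ _ _ OW tt u))).
Proof.
have [mF [M FM]] :=
  bounded_borel_continuous X0 clX cptX (differentiable_within_continuous dF).
apply: (@bounded_integrable _ _ _ _ _ M) => [|u]; last exact/FM/warm_start_in.
case: HW => mW _ _.
apply: (measurable_comp (closed_borel_measurable clX) _ mF mW).
by move=> _ [u _ <-]; exact: warm_start_in.
Qed.

Section implementation.
Context (unbiased : vec -> vec -> prog R d vec).

Lemma surely_recapp T : surely (recapp X alpha unbiased T) (fun _ x => X x).
Proof.
move=> u; apply: (surely_recapp_loop _ _ _ _ _ HA) => //; exact: warm_start_in.
Qed.

Hypothesis proper_unbiased : forall s xp, proper_draws (unbiased s xp).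
Hypothesis HU : unbiased_impl X F lambda OA OW OU unbiased.

Lemma expect_recapp_le T :
  (expect (recapp X alpha unbiased T) (fun _ x => (F x)%:E) <=
   (minval X F + alpha T ^+ 2 * (3 / 2 * (lambda * D ^+ 2)))%:E)%E.
Proof.
have [Xy ymin] := argminP X0 cptX (differentiable_within_continuous dF).
set y := argmin X F in Xy ymin; rewrite -/(minval X F) in ymin.
have a0 : alpha 0%N = 1 by case: Halpha.
pose g := alpha T ^+ 2.
have g0 : 0 <= g by exact: sqr_ge0.
apply: (@le_trans _ _ (\int[seed_law OW]_u
   (minval X F - g * minval X F + g * (lambda / 2 * D ^+ 2)
    + g * F (@answer _ _ _ OW tt u))%:E)%E).
  apply: le_integral_nonmeasurable => u; have Xu := warm_start_in u.
  apply: le_trans (expect_recapp_loop_le X0 clX cvX cptX cvF dF lambda0 HA Halpha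
    proper_unbiased HU T 0 Xu Xu Xy) _.
  rewrite lee_fin add0n a0 expr1n invr1 mul1r -/(minval X F) -/g.
  have : enorm (answer tt u - y) ^+ 2 <= D ^+ 2.
    by rewrite lerXn2r ?nnegrE ?enorm_ge0 ?XD// (le_trans (enorm_ge0 _) (XD Xu Xy)).
  move=> /(ler_wpM2l (ltW lambda0)) /(ler_wpM2l g0); rewrite /minval -/y; lra.
rewrite expectation_affine; last exact: warm_start_integrable.
apply: le_trans (leeD2l _ (lee_wpmul2l _ warm_start_mean)) _; first by rewrite lee_fin.
by rewrite -EFinM -EFinD lee_fin -/g; lra.
Qed.

Lemma expect_recapp0_le :
  (expect (recapp X alpha unbiased 0) (fun _ x => (F x)%:E) <=
   (minval X F + lambda * D ^+ 2)%:E)%E.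
Proof. exact: warm_start_mean. Qed.

End implementation.

Lemma surely_recapp_loop_calls n t x v : X x -> X v ->
  surely (recapp_loop X alpha (@call_unbiased R d) n t x v)
    (fun c y => X y /\ c = Calls 0 n n).
Proof.
elim: n t x v => [|n IH] t x v Xx Xv //= u u'.
have Xs := recapp_query_in cvX Halpha t Xx Xv.
set s := _ + _ in Xs *.
apply: surely_sub (IH t.+1 _ _ _ _).
- by move=> c y [Xy ->] /=; split=> //.
- exact: (approx_in HA).
- exact: (projP X0 cvX cptX _).1.
Qed.

End recapp_guarantees.

Theorem theorem1 (R : realType) :
  exists C : R, 0 < C /\
  forall (d : nat) (X : set 'rV[R]_d) (D : R) (F : 'rV[R]_d -> R)
    (lambda eps : R),
  X !=set0 -> closed X -> convex_set (X : set (convex_lmodType 'rV[R]_d)) ->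
  0 < D -> (forall x y, X x -> X y -> enorm (x - y) <= D) ->
  convex_function (X : set (convex_lmodType 'rV[R]_d)) F ->
  differentiable_on X F ->
  0 < lambda -> 0 < eps ->
  let budget := C * Num.sqrt (lambda * D ^+ 2 / eps) in
  exists T : nat, T%:R <= budget /\
  forall (alpha : nat -> R) (OW : oracle R d unit)
    (OA : oracle R d ('rV[R]_d * 'rV[R]_d * 'rV[R]_d))
    (OU : oracle R d ('rV[R]_d * 'rV[R]_d)),
  recapp_weights alpha ->
  is_WarmStart X F lambda D OW ->
  is_ApproxProx X F lambda OA ->
  (is_UnbiasedProx X F lambda OU ->
    let run := recapp X alpha (@call_unbiased R d) T in
    [/\ surely OW OA OU run (fun c x =>
          [/\ X x, n_warm c = 1%N, (n_approx c)%:R <= budget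
            & (n_unbiased c)%:R <= budget])
      & (expect OW OA OU run (fun _ x => (F x)%:E) - (minval X F)%:E
          <= eps%:E)%E]) /\
  (let run := recapp X alpha (mlmc 2^-1 2) T in
    [/\ surely OW OA OU run (fun _ x => X x),
        (expect OW OA OU run (fun _ x => (F x)%:E) - (minval X F)%:E
          <= eps%:E)%E
      & (expect OW OA OU run (fun c _ => (n_approx c)%:R%:E)
          <= budget%:E)%E]).
Proof.
(* T <= 3 S iterations, with five calls each on average *)
exists 15; split=> // d X D F lambda eps X0 clX cvX D0 XD cvF dF lambda0 eps0; cbv zeta.
set S := Num.sqrt (lambda * D ^+ 2 / eps); set budget := 15 * S.
have LD0 : 0 < lambda * D ^+ 2 by rewrite mulr_gt0// exprn_gt0.
have S0 : 0 < S by rewrite sqrtr_gt0 divr_gt0.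
have S2 : lambda * D ^+ 2 = S ^+ 2 * eps.
  by rewrite sqr_sqrtr ?divfK ?gt_eqF// ltW// divr_gt0.
(* for S <= 1 the warm start is already accurate enough, and the budget may be
   less than one iteration *)
pose T := if S <= 1 then 0%N else Num.truncn (3 * S).
have T5 : 5 * T%:R <= budget.
  rewrite /budget /T; case: ifP => _; first by rewrite mulr0 mulr_ge0// ltW.
  have /andP[h _] := truncn_itv (ltW (mulr_gt0 (ltr0n R 3) S0)).
  lra.
have T0 := ler0n R T.
have Tb : T%:R <= budget by lra.
have cptX := bounded_diameter_compact X0 clX XD.
exists T; split=> // alpha OW OA OU Halpha HW HA.
have gap unbiased : (forall s xp, proper_draws (unbiased s xp)) ->
  unbiased_impl X F lambda OA OW OU unbiased ->
  (expect OW OA OU (recapp X alpha unbiased T) (fun _ x => (F x)%:E) - (minval X F)%:E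
   <= eps%:E)%E.
  move=> proper HU; rewrite leeBlDr// -EFinD addrC.
  have [S1|S1] := leP S 1.
    rewrite /T S1; apply: le_trans (expect_recapp0_le OA OU HW alpha unbiased) _.
    rewrite lee_fin lerD2l S2 -[leRHS]mul1r ler_wpM2r ?(ltW eps0)//.
    by rewrite exprn_ile1// ltW.
  apply: le_trans (expect_recapp_le X0 clX cvX XD cvF dF lambda0 HW HA Halpha proper HU T) _.
  rewrite lee_fin lerD2l S2.
  have a0 := recapp_weights_gt0 Halpha T; have := recapp_weights_growth Halpha T.
    have hT : 3 * S < T%:R + 1.
    rewrite natr1 /T leNgt S1 /=.
    by have /andP[] := truncn_itv (ltW (mulr_gt0 (ltr0n R 3) S0)).
  move=> hb; have Sb : 3 / 2 * S <= (alpha T)^-1 by lra.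
  have aS : alpha T * (3 / 2 * S) <= 1 by rewrite mulrC -ler_pdivlMr// div1r.
  have aS0 : 0 <= alpha T * (3 / 2 * S) by rewrite !mulr_ge0// ltW.
  have : (alpha T * (3 / 2 * S)) ^+ 2 <= 1 by rewrite exprn_ile1.
  move=> /(ler_wpM2r (ltW eps0)); nra.
split.
  move=> HU; split; last first.
    by apply: gap => //; exact: (unbiased_impl_call clX OA OW HU).
  move=> u; have Xu := warm_start_in HW u.
  apply: surely_sub (surely_recapp_loop_calls X0 clX cvX XD OW OU HA Halpha T 0 Xu Xu).
  by move=> c y [Xy ->]; split=> //=; rewrite add0n.
have proper := @proper_draws_mlmc R d; split.
- exact: (surely_recapp X0 clX cvX XD OU HW HA Halpha).
- apply: gap => //; exact: (unbiased_impl_mlmc X0 clX cvX cptX cvF dF lambda0 HA).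
- rewrite (_ : (fun c _ => _) = approx_count 0 (A := _)); last first.
    by apply/funext => c; apply/funext => y; rewrite /approx_count addr0.
  apply: expectation_le => u; rewrite approx_count_add.
  apply: le_trans (expect_recapp_loop_count (q := 4) _ _ _ _ _ _ _ _ _ _) _ => //.
  + by move=> s xp r r0; exact: expect_mlmc_count.
  + by rewrite lee_fin; lra.
Qed.
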